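(* Let $n\geq 15$ with $n\equiv 3\pmod 4$, let $r$ be odd with $7\leq r<(n-1)/2$, and put $L=n-2r$. Let $V$ consist of the $n$ distinct vertices $p_1,p_2,p_3,q_0=p_4,q_1,\dots,q_L,y_3,\dots,y_r,z_3,\dots,z_r$, and write $y_2:=q_L$. Consider the labelled graph on $V$ with edges: $\{p_1,p_2\}$ with label $0$; $\{p_2,p_3\}$ with label $1$; $\{p_3,p_4\}$ with the two labels $0$ and $2$; $\{q_{s-1},q_s\}$ for $1\leq s\leq L$ with label $1$ if $s$ is odd and $0$ if $s$ is even; $\{y_k,y_{k+1}\}$ with label $k$ for $2\leq k\leq r-1$; $\{z_k,z_{k+1}\}$ with label $k$ for $3\leq k\leq r-1$; and $\{y_{r-1},z_{r-1}\}$, $\{y_r,z_r\}$ with label $r-3$. Then $G\cong A_n$ and $(G,(\rho_0,\dots,\rho_{r-1}))$ is a string C-group of rank $r$ with Schläfli type $\{n-2(r-2),12,6,3^{r-7},6,6,3\}$.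
   Context: A string group generated by involutions (sggi) of rank $r$ is a pair $(G,(\rho_0,\dots,\rho_{r-1}))$ where $\rho_0,\dots,\rho_{r-1}$ are involutions generating the group $G$ such that $(\rho_i\rho_j)^2=1$ whenever $|i-j|\geq 2$. It is a string C-group if in addition it satisfies the intersection property: for all $J,K\subseteq\{0,\dots,r-1\}$, $\langle \rho_j : j\in J\rangle\cap\langle\rho_k : k\in K\rangle=\langle \rho_j : j\in J\cap K\rangle$. The Schläfli type is $\{p_1,\dots,p_{r-1}\}$ where $p_i$ is the order of $\rho_{i-1}\rho_i$; $3^k$ denotes $k$ consecutive entries equal to $3$ (omitted if $k=0$). Labelled-graph convention: the vertex set $V$ is finite, and each edge $\{a,b\}$ ($a\neq b$) carries one or more labels from $\{0,\dots,r-1\}$, the edges carrying any given label being pairwise disjoint; $\rho_k$ denotes the permutation of $V$ equal to the product of the transpositions $(a\,b)$ over all edges $\{a,b\}$ carrying label $k$, and $G=\langle\rho_0,\dots,\rho_{r-1}\rangle\leq \mathrm{Sym}(V)$. *)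

(* Defs.v *)
From HB Require Import structures.
From mathcomp Require Import all_boot all_fingroup all_solvable.
Set Implicit Arguments. Unset Strict Implicit. Unset Printing Implicit Defensive.
Local Open Scope group_scope.

Definition gen_by (gT : finGroupType) (r : nat) (rho : nat -> gT) (J : {set 'I_r})
  : {group gT} := <<[set rho (val j) | j in J]>>%G.

Definition sggi (gT : finGroupType) (r : nat) (rho : nat -> gT) : Prop :=
  (forall i, (i < r)%N -> #[rho i] = 2%N) /\
  (forall i j, (i < r)%N -> (j < r)%N -> (i.+2 <= j \/ j.+2 <= i)%N ->
       (rho i * rho j) ^+ 2 = 1).

Definition intersection_property (gT : finGroupType) (r : nat) (rho : nat -> gT)
  : Prop :=
  forall J K : {set 'I_r},
    gen_by rho J :&: gen_by rho K = gen_by rho (J :&: K).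

Definition string_C_group (gT : finGroupType) (r : nat) (rho : nat -> gT) : Prop :=
  sggi r rho /\ intersection_property r rho.

(* Schlafli type {p_1, ..., p_{r-1}} given as the sequence s, p_i = nth 0 s (i-1) *)
Definition schlafli_type (gT : finGroupType) (r : nat) (rho : nat -> gT)
  (s : seq nat) : Prop :=
  size s = r.-1 /\ (forall i, (i.+1 < r)%N -> #[rho i * rho i.+1] = nth 0%N s i).

(* Vertex set V = 'I_n, encoded as:
     p1 = 0, p2 = 1, p3 = 2, q_s = 3 + s (0 <= s <= L), so p4 = q_0 = 3,
     y_k = L + 1 + k (2 <= k <= r)  (so y_2 = q_L = L + 3),
     z_k = L + r + k - 1 (3 <= k <= r)  (z_r = L + 2r - 1 = n - 1),
   where L = n - 2r. *)

(* labelled edges as triples (label, a, b); an edge with two labels appears twice *)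
Definition edges (n r : nat) : seq (nat * nat * nat) :=
  let L := (n - 2 * r)%N in
  [:: (0, 0, 1); (1, 1, 2); (0, 2, 3); (2, 2, 3)]%N
  ++ [seq ((if odd s then 1 else 0), 2 + s, 3 + s) | s <- iota 1 L]%N
  ++ [seq (k, L + 1 + k, L + 2 + k) | k <- iota 2 (r - 2)]%N
  ++ [seq (k, L + r + k - 1, L + r + k) | k <- iota 3 (r - 3)]%N
  ++ [:: (r - 3, L + r, L + 2 * r - 2); (r - 3, L + r + 1, L + 2 * r - 1)]%N.

(* transposition (a b) of 'I_n (identity if an index is out of range; never
   happens for the edges above) *)
Definition transp (n a b : nat) : {perm 'I_n} :=
  match insub a, insub b with
  | Some x, Some y => tperm x y
  | _, _ => 1
  end.

Definition rho (n r k : nat) : {perm 'I_n} :=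
  foldr (fun e acc => if e.1.1 == k then transp n e.1.2 e.2 * acc else acc)
        1 (edges n r).

Definition Ggrp (n r : nat) : {group {perm 'I_n}} := gen_by (rho n r) [set: 'I_r].

Definition type48 (n r : nat) : seq nat :=
  [:: n - 2 * (r - 2); 12; 6]%N ++ nseq (r - 7) 3%N ++ [:: 6; 6; 3]%N.

(* Main.v *)
(* By induction on intervals of generators, the intersection property follows from
   <rho_i, ..., rho_(j-1)> meet <rho_(i+1), ..., rho_j> = <rho_(i+1), ..., rho_(j-1)> for i < j.
   For i >= 3 the generators act on the blocks {y_k, z_k} like adjacent transpositions up to sign
   changes, and a Schreier coset argument for the stabiliser of a vertex or of a block applies.
   For i <= 2 the groups contain 3-cycles, (rho_1 rho_2)^4 or (rho_2 rho_3)^2, hence the alternating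
   group on the orbit X of y_2; modulo this normal subgroup rho_1 and rho_2 commute with the later
   generators, so <rho_1, ..., rho_m> = Alt(X) <rho_1, rho_2> <rho_3, ..., rho_m>, and the three
   factors of an element of the intersection are controlled by the vertices it fixes.
   Growing the support of the same 3-cycles along the whole graph gives the alternating group, as
   all the generators are even. *)

Require Import Defs.
From HB Require Import structures.
From mathcomp Require Import all_boot all_fingroup all_solvable.
From mathcomp Require Import zify.
Set Implicit Arguments. Unset Strict Implicit. Unset Printing Implicit Defensive.
Local Open Scope group_scope.

(** The obstacle is the label [r - 3], which besides its edges in the y chain and the z chain
    carries the two rungs y_(r-1) z_(r-1) and y_r z_r. They break exactly two braid relations among
    the generators of index at least 3: the cubes of [rho (r - 4) * rho (r - 3)] and of
    [rho (r - 3) * rho (r - 2)] are involutions flipping blocks. The cosets are therefore counted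
    modulo a subgroup [Q] that absorbs these cubes; where an interval is too short to contain [tau],
    it is adjoined first and excluded afterwards. The rungs also decide when z vertices join the
    orbit of y_2, namely only once [rho (r - 2)] is present. This is why the case i = 0 splits into
    j <= r - 3, j = r - 2 and j = r - 1: in the middle case the y and z vertices lie in different
    orbits, and the parities of the two restrictions have to be balanced. *)

Ltac nat_lia :=
  repeat match goal with
  | H : is_true (_ \in _) |- _ => clear H
  | H : is_true (perm_on _ _) |- _ => clear H
  | H : is_true (~~ odd_perm _) |- _ => clear H
  | H : @eq ?T _ _ |- _ => tryif first [unify T nat | unify T bool] then fail else clear H
  | H : forall _, _ |- _ => clear H
  end; lia.

(** Conditions free of nested conditionals are split first, and impossible branches are closed at
    once, which keeps the case tree small. *)
Ltac ifs := repeat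
  match goal with
  | |- context [if (?a < ?b)%N then _ else _] =>
    lazymatch a with context [if _ then _ else _] => fail | _ =>
    lazymatch b with context [if _ then _ else _] => fail | _ =>
      case: (ltnP a b) => ?; try (exfalso; nat_lia) end end
  | |- context [if ?b then _ else _] =>
    lazymatch b with context [if _ then _ else _] => fail | (_ < _)%N => fail | _ =>
      case: (boolP b) => ?; try (exfalso; nat_lia) end end; try nat_lia.

(** * The intersection property from intervals of generators *)

Section Parabolic.
Variables (gT : finGroupType) (r : nat) (rho : nat -> gT).
Implicit Types (J K : {set 'I_r}) (g : gT).
Local Notation G := (gen_by rho).

Lemma mem_gen_by J (k : 'I_r) : k \in J -> rho k \in G J.
Proof. by move=> kJ; apply: mem_gen; apply/imsetP; exists k. Qed.

Lemma gen_by_subG J (H : {group gT}) :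
  (forall k : 'I_r, k \in J -> rho k \in H) -> G J \subset H.
Proof. by move=> JH; rewrite gen_subG; apply/subsetP=> _ /imsetP[k kJ ->]; apply: JH. Qed.

Lemma gen_byS J K : J \subset K -> G J \subset G K.
Proof. by move=> /subsetP sJK; apply: gen_by_subG => k /sJK; apply: mem_gen_by. Qed.

Lemma gen_by_ind J (P : gT -> Prop) :
  P 1 -> (forall g (k : 'I_r), k \in J -> P g -> P (g * rho k)) ->
  forall g, g \in G J -> P g.
Proof.
move=> P1 PM g /gen_prodgP[m [c cJ ->]].
elim: m c cJ => [|m IHm] c cJ; first by rewrite big_ord0.
rewrite big_ord_recr /=; have /imsetP[k kJ ->] := cJ ord_max.
by apply: PM => //; apply: IHm => i; apply: cJ.
Qed.

Definition itv_set i j : {set 'I_r} := [set k : 'I_r | (i <= k < j)%N].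
Definition itv_gen i j := G (itv_set i j).

Lemma itv_setS i j i' j' : (i' <= i)%N -> (j <= j')%N -> itv_set i j \subset itv_set i' j'.
Proof. by move=> ii' jj'; apply/subsetP=> k; rewrite !inE; lia. Qed.

Lemma itv_genS i j i' j' g :
  (i' <= i)%N -> (j <= j')%N -> g \in itv_gen i j -> g \in itv_gen i' j'.
Proof. by move=> ii' jj'; apply: (subsetP (gen_byS (itv_setS _ _))). Qed.

Lemma itv_gen_mem i j k : (i <= k < j)%N -> (k < r)%N -> rho k \in itv_gen i j.
Proof.
by move=> kij kr; rewrite -[k]/(val (Ordinal kr)); apply: mem_gen_by; rewrite inE.
Qed.

Lemma itv_gen_ind i j (P : gT -> Prop) :
  P 1 -> (forall g k, (i <= k < j)%N -> (k < r)%N -> P g -> P (g * rho k)) ->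
  forall g, g \in itv_gen i j -> P g.
Proof.
by move=> P1 PM; apply: gen_by_ind => // g k; rewrite inE => kij; apply: PM.
Qed.

Lemma itv_gen_nil i j g : (j <= i)%N -> g \in itv_gen i j -> g = 1.
Proof. by move=> ji; move: g; apply: itv_gen_ind => // g k; lia. Qed.

Hypothesis rho_sggi : sggi r rho.

Lemma sggi_sqr k : (k < r)%N -> rho k * rho k = 1.
Proof. by case: rho_sggi => [ord2 _] kr; rewrite -expg2 -(ord2 k kr) expg_order. Qed.

Lemma sggi_inv k : (k < r)%N -> (rho k)^-1 = rho k.
Proof. by move=> kr; apply/eqP; rewrite eq_invg_mul sggi_sqr. Qed.

Lemma sggi_commute i j : (i < r)%N -> (j < r)%N -> (i.+2 <= j)%N -> commute (rho i) (rho j).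
Proof.
case: rho_sggi => _ com ir jr ij; rewrite /commute.
have /eqP := com i j ir jr (or_introl ij).
by rewrite expg2 -eq_invg_mul invMg !sggi_inv // => /eqP.
Qed.

(** Indices on the two sides of the missing [m] differ by at least 2, so their generators commute
    and every word can be sorted. *)
Lemma gen_by_split J m g :
  (forall k : 'I_r, k \in J -> val k != m) -> g \in G J ->
  exists2 u, u \in G [set k in J | (k < m)%N] &
  exists2 v, v \in G [set k in J | (m < k)%N] & g = u * v.
Proof.
move=> mJ; move: g; apply: gen_by_ind.
  by exists 1; rewrite ?group1 //; exists 1; rewrite ?group1 ?mulg1.
move=> _ k kJ [u uG [v vG ->]]; have := mJ k kJ; rewrite neq_ltn => /orP[km|mk].
  exists (u * rho k); first by rewrite groupM // mem_gen_by // inE kJ.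
  exists v => //; rewrite -!mulgA; congr (u * _).
  suff /subsetP/(_ v vG)/cent1P: G [set k in J | (m < k)%N] \subset 'C[rho k] by [].
  apply: gen_by_subG => l; rewrite inE => /andP[_ ml]; apply/cent1P/commute_sym.
  by apply: sggi_commute => //; apply: leq_ltn_trans ml.
by exists u => //; exists (v * rho k); rewrite ?mulgA // groupM // mem_gen_by // inE kJ.
Qed.

Hypothesis itv_step : forall i j, (i < j)%N -> (j < r)%N ->
  forall g, g \in itv_gen i j -> g \in itv_gen i.+1 j.+1 -> g \in itv_gen i.+1 j.

(** Induction on the length of the hull from [i] to [j']. [itv_step] applied to the hull without its
    last and without its first generator removes both; the three remaining comparisons take place in
    shorter hulls. *)
Lemma itv_gen_meet i j i' j' g : (i <= i')%N -> (j <= j')%N -> (j' <= r)%N ->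
  g \in itv_gen i j -> g \in itv_gen i' j' -> g \in itv_gen i' j.
Proof.
have [N le_N] := ubnP (j' - i)%N.
elim: N => // N IH in i j i' j' le_N g *; move=> ii' jj' jr gI gJ.
have [Ei|ne_i] := eqVneq i i'; first by rewrite -Ei.
have [Ej|ne_j] := eqVneq j j'; first by rewrite Ej.
have [j'i'|i'j'] := leqP j' i'; first by rewrite (itv_gen_nil j'i' gJ) group1.
have gM : g \in itv_gen i.+1 j'.-1.
  apply: itv_step; [lia | lia | | ].
    by apply: itv_genS gI; lia.
  by apply: itv_genS gJ; lia.
have g1 : g \in itv_gen i.+1 j by apply: (IH i j i.+1 j'.-1) => //; lia.
have g2 : g \in itv_gen i' j'.-1 by apply: (IH i.+1 j'.-1 i' j') => //; lia.
by apply: (IH i.+1 j i' j'.-1) => //; lia.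
Qed.

Lemma first_gap a K : (a <= r)%N -> exists m,
  [/\ (a <= m)%N, forall k : 'I_r, k \in K -> val k != m & itv_set a m \subset K].
Proof.
move=> ar; pose P := [pred m | (a <= m)%N && [forall k : 'I_r, (k \in K) ==> (val k != m)]].
have exP : exists m, P m.
  (* [r] is the value of no index, so it is always a gap. *)
  exists r; rewrite /= ar; apply/forallP=> k; apply/implyP=> _.
  by rewrite neq_ltn ltn_ord.
case: (ex_minnP exP) => m /andP[am /forallP mK] minm; exists m; split=> //.
  by move=> k; apply/implyP.
apply/subsetP=> k; rewrite inE => /andP[ak km]; apply: contraLR km => kK.
rewrite -leqNgt; apply: minm; rewrite /= ak; apply/forallP=> l; apply/implyP=> lK.
by apply: contraNneq kK => /val_inj <-.
Qed.

(** Split [g] at the first gap of [K]. The factor above the gap avoids [a] already, so the factor on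
    the initial run lies in two groups generated by intervals, and [itv_gen_meet] removes [a] from
    it. *)
Lemma gen_by_meet_drop J K (a : 'I_r) g :
  (forall k, k \in J -> (a < k)%N) -> (forall k, k \in K -> (a <= k)%N) ->
  g \in G J -> g \in G K -> g \in G (K :\ a).
Proof.
move=> aJ aK gJ gK; have [m [am mK sK]] := first_gap K (ltnW (ltn_ord a)).
have sJ : g \in itv_gen a.+1 r.
  by apply: subsetP gJ; apply: gen_byS; apply/subsetP=> k /aJ; rewrite inE ltn_ord andbT.
have [u uG [v vG Eg]] := gen_by_split mK gK.
have vK : v \in G (K :\ a).
  apply: subsetP vG; apply: gen_byS; apply/subsetP=> k; rewrite !inE => /andP[-> mk].
  by rewrite andbT; apply: contraTneq mk => ->; rewrite -leqNgt.
have v1 : v \in itv_gen a.+1 r.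
  apply: subsetP vK; apply: gen_byS; apply/subsetP=> k; rewrite !inE => /andP[ka /aK ak].
  by rewrite ltn_ord andbT ltn_neqAle ak andbT eq_sym.
rewrite Eg groupM //; have [mr|rm] := leqP m r.
  have uI : u \in itv_gen a.+1 m.
    apply: (itv_gen_meet (i := a) (j' := r)) => //.
      apply: subsetP uG; apply: gen_byS; apply/subsetP=> k.
      by rewrite !inE => /andP[/aK -> ->].
    by move: sJ; rewrite Eg groupMr.
  apply: subsetP uI; apply: gen_byS; apply/subsetP=> k; rewrite !inE => /andP[ak km].
  by rewrite (subsetP sK) ?inE ?(ltnW ak) // andbT; apply: contraTneq ak => ->; rewrite ltnn.
have : u \in itv_gen a.+1 r by move: sJ; rewrite Eg groupMr.
apply/subsetP/gen_byS/subsetP=> k; rewrite !inE => /andP[ak km].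
rewrite (subsetP sK) ?inE; last by rewrite (ltnW ak) /=; lia.
by rewrite andbT; apply: contraTneq ak => ->; rewrite ltnn.
Qed.

(* Peel off the least index a of J and K.  If both contain it, split off the runs of
   consecutive indices of J and of K starting at a: the shorter run lies in J and K. *)
Lemma intersection_of_intervals : intersection_property r rho.
Proof.
suff H a : (a <= r)%N -> forall J K, (forall k, k \in J -> (a <= k)%N) ->
    (forall k, k \in K -> (a <= k)%N) ->
    forall g, g \in G J -> g \in G K -> g \in G (J :&: K).
  move=> J K; apply/eqP; rewrite eqEsubset; apply/andP; split.
    by apply/subsetP=> g /setIP[]; apply: (H 0).
  by rewrite subsetI !gen_byS // ?subsetIl ?subsetIr.
elim: {a}(r - a)%N {-2}a (erefl (r - a)%N) => [|N IH] a EN ar J K aJ aK.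
  have J0 : J = set0 by apply/setP=> k; rewrite inE; apply: contraTF (ltn_ord k) => /aJ; lia.
  by rewrite J0 set0I.
have {}ar : (a < r)%N by lia.
pose oa := Ordinal ar.
have H1 J' K' : (forall k, k \in J' -> (a < k)%N) -> (forall k, k \in K' -> (a <= k)%N) ->
    forall g, g \in G J' -> g \in G K' -> g \in G (J' :&: K').
  move=> aJ' aK' g gJ gK.
  have gKa : g \in G (K' :\ oa) by apply: (@gen_by_meet_drop J').
  have : g \in G (J' :&: (K' :\ oa)).
    apply: (IH a.+1) => //; first lia.
    move=> k; rewrite !inE => /andP[ka /aK']; rewrite leq_eqVlt => /orP[/eqP E|//].
    by case/eqP: ka; apply: val_inj.
  by apply: (subsetP (gen_byS _)); rewrite setIS ?subD1set.
have drop J' : oa \notin J' -> (forall k, k \in J' -> (a <= k)%N) ->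
   forall k, k \in J' -> (a < k)%N.
  move=> aJ' leJ k kJ; have := leJ k kJ; rewrite leq_eqVlt => /orP[/eqP E|//].
  by case/negP: aJ'; rewrite (_ : oa = k) //; apply: val_inj.
move=> g gJ gK.
have [aJ'|aJ'] := boolP (oa \in J); last by apply: H1 => //; apply: drop.
have [aK'|aK'] := boolP (oa \in K); last by rewrite setIC; apply: H1 => //; apply: drop.
have [mJ [amJ mJJ sJ]] := first_gap J (ltnW ar).
have [mK [amK mKK sK]] := first_gap K (ltnW ar).
wlog le_m : J K mJ mK aJ aK gJ gK aJ' aK' amJ amK mJJ mKK sJ sK / (mJ <= mK)%N.
  move=> W; have [le_m|lt_m] := leqP mJ mK; first exact: (W J K mJ mK).
  by rewrite setIC; apply: (W K J mK mJ) => //; apply: ltnW.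
have [u uG [v vG Eg]] := gen_by_split mJJ gJ.
have sub1 : [set k in J | (k < mJ)%N] \subset J :&: K.
  apply/subsetP=> k; rewrite !inE => /andP[kJ km]; rewrite kJ (subsetP sK) // inE aJ //=.
  exact: leq_trans le_m.
have uI := subsetP (gen_byS sub1) _ uG.
rewrite Eg groupM //.
have vK : v \in G K.
  by move: gK; rewrite Eg groupMl // (subsetP (gen_byS (subsetIr J K))).
suff : v \in G ([set k in J | (mJ < k)%N] :&: K).
  by apply: (subsetP (gen_byS _)); apply/setSI/subsetP=> k; rewrite inE => /andP[].
by apply: H1 => // k; rewrite inE => /andP[_]; apply: leq_ltn_trans.
Qed.

End Parabolic.

(** * Coset representatives *)

(* In a symmetric group generated by the adjacent transpositions [s a], the [t m] represent the
   cosets of the stabiliser of a point.  The braid relations are only required up to [Q]. *)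
Section Schreier.
Variables (gT : finGroupType) (s : nat -> gT) (l : nat) (Q : {group gT}).
Let t m := \prod_(k < m) s k.
Hypothesis s_sqr : forall a, (a <= l)%N -> s a * s a = 1.
Hypothesis s_com : forall a b, (a.+2 <= b)%N -> (b <= l)%N -> commute (s a) (s b).
Hypothesis s_in : forall a, (0 < a)%N -> (a <= l)%N -> s a \in Q.
Hypothesis s_braid : forall a, (a < l)%N -> t a * (s a * s a.+1) ^+ 3 * (t a)^-1 \in Q.

Let tS m : t m.+1 = t m * s m.
Proof. by rewrite /t big_ord_recr. Qed.

Lemma t_com m b : (m < b)%N -> (b <= l)%N -> commute (t m) (s b).
Proof.
elim: m => [|m IH] mb bl; first by rewrite /t big_ord0; apply: commute_sym; apply: commute1.
rewrite tS; apply: commute_sym; apply: commuteM; apply: commute_sym.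
  by apply: IH => //; apply: ltnW.
exact: s_com.
Qed.

(** With e the cube of [s a * s a.+1], involutivity gives s_a s_(a+1) s_a = e s_(a+1) s_a s_(a+1).
    As [t a] commutes with [s a.+1], moving [s a] leftwards through [t a.+2] turns it into [s a.+1],
    up to the conjugate of e that [s_braid] puts in [Q]; the later factors of [t m] commute with
    [s a]. *)
Lemma t_conj a m : (a.+1 < m)%N -> (m <= l.+1)%N -> t m * s a * (t m)^-1 \in Q.
Proof.
move=> am ml.
have Em : forall d, (a.+2 + d <= l.+1)%N ->
    t (a.+2 + d) * s a = (t a * (s a * s a.+1) ^+ 3 * (t a)^-1) * s a.+1 * t (a.+2 + d).
  elim=> [|d IH] dl.
    have E : s a * s a.+1 * s a = (s a * s a.+1) ^+ 3 * (s a.+1 * s a * s a.+1).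
      rewrite !expgS expg0 mulg1 !mulgA -(mulgA _ (s a.+1) (s a.+1)).
      rewrite s_sqr ?mulg1; last lia.
      rewrite -[_ * s a * s a]mulgA s_sqr ?mulg1; last lia.
      by rewrite -[_ * s a.+1 * s a.+1]mulgA s_sqr ?mulg1 //; lia.
    have C : t a * s a.+1 = s a.+1 * t a by apply: t_com; lia.
    have D : (t a)^-1 * s a.+1 * t a = s a.+1 by rewrite -mulgA -C mulKg.
    rewrite addn0 !tS; move: E; set e := _ ^+ 3 => E.
    transitivity (t a * (s a * s a.+1 * s a)); first by rewrite !mulgA.
    transitivity (t a * e * ((t a)^-1 * s a.+1 * t a) * s a * s a.+1).
      by rewrite D E !mulgA.
    by rewrite !mulgA.
  rewrite addnS tS -mulgA.
  have -> : s (a.+2 + d) * s a = s a * s (a.+2 + d).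
    by apply: commute_sym; apply: s_com; lia.
  by rewrite mulgA IH ?mulgA //; lia.
rewrite -(subnKC am) Em ?subnKC // mulgK groupM //; first by apply: s_braid; lia.
by apply: s_in; lia.
Qed.

(** [s m] lengthens the representative, the last factor of [t m] shortens it, later generators
    commute past it, and earlier ones are absorbed by [t_conj]. So the union of the cosets of the
    [t m] is stable under right multiplication. *)
Lemma schreier_step m a : (m <= l.+1)%N -> (a <= l)%N ->
  exists2 m', (m' <= l.+1)%N & exists2 q, q \in Q & t m * s a = q * t m'.
Proof.
move=> ml al; case: (ltngtP a m) => [am|ma|Em].
- have [Em|lt_am] := leqP m a.+1.
    have {Em am ml} -> : m = a.+1 by lia.
    exists a; first lia.
    by exists 1; rewrite // mul1g tS -mulgA s_sqr ?mulg1.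
  exists m => //; exists (t m * s a * (t m)^-1); first exact: t_conj.
  by rewrite mulgKV.
- exists m => //; exists (s a); first by apply: s_in; lia.
  by rewrite t_com.
exists m.+1; first by rewrite -Em ltnS.
by exists 1; rewrite ?mul1g ?tS ?Em.
Qed.

End Schreier.

(** * Alternating groups on subsets *)

Section AltIn.
Variable T : finType.
Implicit Types (X : {set T}) (H : {group {perm T}}).

Definition alt_in X H := forall g : {perm T}, perm_on X g -> ~~ odd_perm g -> g \in H.

Lemma perm_on_fix X u (g : {perm T}) : perm_on (u |: X) g -> g u = u -> perm_on X g.
Proof.
move=> /subsetP gX gu; apply/subsetP=> x gx; have := gX x gx.
by rewrite !inE => /orP[/eqP E|//]; rewrite inE E gu eqxx in gx.
Qed.

Lemma perm_onS X X' (g : {perm T}) : X \subset X' -> perm_on X g -> perm_on X' g.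
Proof. by move=> sX gX; apply: subset_trans sX. Qed.

Lemma perm_on_tperm X a b : a \in X -> b \in X -> perm_on X (tperm a b).
Proof.
by move=> aX bX; apply: perm_onS (tperm_on a b); apply/subsetP=> x /set2P[]->.
Qed.

(** It suffices to find an even [h] in [H] with [h u = g u], since [g * h^-1] then fixes [u] and is
    supported on [X]. The given 3-cycle sends [u] to [a], its inverse sends [u] to [b], and any
    other image is reached by a further 3-cycle inside [X]. Two points in [X] are enough, so growth
    can start from a pair. *)
Lemma alt_in_cycle3 X H a b u : alt_in X H -> a \in X -> b \in X -> a != b -> u \notin X ->
  tperm a b * tperm a u \in H -> alt_in (u |: X) H.
Proof.
move=> altX aX bX ab uX cH g gX ge.
have neu x : x \in X -> x != u by apply: contraTneq => ->.
have aX' : a \in u |: X by rewrite inE aX orbT.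
have bX' : b \in u |: X by rewrite inE bX orbT.
have uX' : u \in u |: X by rewrite !inE eqxx.
have onX' : forall x, x \in u |: X -> perm_on (u |: X) (tperm a b * tperm a x).
  by move=> x xX; rewrite perm_onM ?perm_on_tperm.
have ev : ~~ odd_perm (tperm a b * tperm a u) by rewrite odd_permM !odd_tperm ab neu.
suff [h [hH hX he hu]] : exists h : {perm T},
    [/\ h \in H, perm_on (u |: X) h, ~~ odd_perm h & h u = g u].
  rewrite -[g](mulgKV h) groupM //; apply: altX.
    apply: (@perm_on_fix _ u); first by rewrite perm_onM ?perm_onV.
    by rewrite permM -hu permK.
  by rewrite odd_permM odd_permV (negbTE ge) (negbTE he).
have [gu|gu] := eqVneq (g u) u.
  by exists 1; rewrite group1 perm_on1 odd_perm1 perm1 gu.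
have gux : g u \in X.
  by have := perm_closed u gX; rewrite uX' => /setU1P[E|//]; rewrite E eqxx in gu.
have [ga|ga] := eqVneq (g u) a.
  exists (tperm a b * tperm a u); split=> //; first exact: onX'.
  by rewrite permM [tperm a b u]tpermD ?neu // tpermR ga.
have [gb|gb] := eqVneq (g u) b.
  exists (tperm a b * tperm a u)^-1; split; rewrite ?groupV ?perm_onV ?odd_permV ?onX' //.
  by rewrite invMg !tpermV permM tpermR tpermL gb.
exists (tperm a b * tperm a u * (tperm a b * tperm b (g u))); split.
- rewrite groupM // altX ?perm_onM ?perm_on_tperm //.
  by rewrite odd_permM !odd_tperm ab eq_sym gb.
- by rewrite perm_onM ?onX' // perm_onM ?perm_on_tperm // inE gux orbT.
- by rewrite odd_permM (negbTE ev) odd_permM !odd_tperm ab eq_sym gb.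
by rewrite !permM [tperm a b u]tpermD ?neu // tpermR !tpermL.
Qed.

(** Conjugation by [h] turns the 3-cycle on [a], [b], [x] into one on [a], [b], [h x]. *)
Lemma alt_in_step X H (h : {perm T}) x a b : alt_in X H -> h \in H ->
  x \in X -> a \in X -> b \in X -> a != b -> a != x -> b != x ->
  h a = a -> h b = b -> alt_in (h x |: X) H.
Proof.
move=> altX hH xX aX bX ab ax bx ha hb.
have [hx|hx] := boolP (h x \in X).
  by rewrite (setUidPr _) // sub1set.
apply: (alt_in_cycle3 altX aX bX ab hx).
have -> : tperm a b * tperm a (h x) = (tperm a b * tperm a x) ^ h.
  by rewrite conjMg !tpermJ ha hb.
rewrite groupJ // altX ?perm_onM ?perm_on_tperm //.
by rewrite odd_permM !odd_tperm ab ax.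
Qed.

(** Only the identity is both even and supported on two points. This starts the induction from a
    single 3-cycle. *)
Lemma alt_in_small X H : (#|X| <= 2)%N -> alt_in X H.
Proof.
move=> X2 g gX; have [->|ne1] := eqVneq g 1; first by rewrite group1.
have [x gx] : exists x, g x != x.
  apply/existsP; apply: contraR ne1 => /existsPn g1; apply/eqP/permP=> x.
  by rewrite perm1; apply/eqP; have := g1 x; rewrite negbK.
have xX : x \in X by apply: contraR gx => xX; rewrite (out_perm gX).
have EX : X = [set x; g x].
  apply/eqP; rewrite eq_sym eqEcard cards2 eq_sym gx X2 andbT.
  by apply/subsetP=> y /set2P[]-> //; rewrite (perm_closed _ gX).
suff -> : g = tperm x (g x) by rewrite odd_tperm eq_sym gx.
have ggx : g (g x) = x.
  have := perm_closed (g x) gX; rewrite (perm_closed x gX) xX EX => /set2P[//|/perm_inj E].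
  by rewrite E eqxx in gx.
apply/permP=> y; case: tpermP => [->|->|/eqP yx /eqP ygx] //.
by apply: (out_perm gX); rewrite EX !inE negb_or yx.
Qed.

End AltIn.

(** * The action of the generators on the vertices *)

Section Action.

Definition swap (a b x : nat) := if x == a then b else if x == b then a else x.

(** In a product of permutations the left factor acts first, so the product built by [foldr] acts on
    a vertex as a [foldl] over the same list. *)
Definition swap_edges (k : nat) (es : seq (nat * nat * nat)) (x : nat) :=
  foldl (fun y e => if e.1.1 == k then swap e.1.2 e.2 y else y) x es.

Lemma transpE n a b (x : 'I_n) : (a < n)%N -> (b < n)%N ->
  transp n a b x = swap a b x :> nat.
Proof.
move=> an bn; rewrite /transp; case: insubP => [u _ ua|]; last by rewrite an.
case: insubP => [v _ vb|]; last by rewrite bn.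
rewrite /swap -ua -vb; case: tpermP => [->|->|/eqP xu /eqP xv].
- by rewrite eqxx.
- by rewrite eqxx; case: eqP => // ->.
by rewrite -!val_eqE in xu xv; rewrite (negbTE xu) (negbTE xv).
Qed.

Lemma rho_swap_edges n r k (x : 'I_n) :
  all (fun e => (e.1.2 < n)%N && (e.2 < n)%N) (edges n r) ->
  rho n r k x = swap_edges k (edges n r) x :> nat.
Proof.
rewrite /rho /swap_edges; elim: (edges n r) x => [|e es IH] x /=; first by rewrite perm1.
case/andP=> /andP[e1 e2] /IH {}IH; case: eqP => _; last exact: IH.
by rewrite permM IH transpE.
Qed.

Lemma swap_edges_cat k s1 s2 x :
  swap_edges k (s1 ++ s2) x = swap_edges k s2 (swap_edges k s1 x).
Proof. exact: foldl_cat. Qed.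

Lemma swap_edges_iota k f1 f2 m d x :
  swap_edges k [seq (l, f1 l, f2 l) | l <- iota m d] x =
    if (m <= k < m + d)%N then swap (f1 k) (f2 k) x else x.
Proof.
rewrite /swap_edges; elim: d m x => [|d IH] m x /=; first by case: ifP => //; lia.
rewrite IH; case: (m =P k) => [->|/eqP mk]; last by congr (if _ then _ else _); lia.
by rewrite ltnn /= ifT //; lia.
Qed.

Lemma swap_edges_path k N x :
  swap_edges k [seq ((if odd s then 1 else 0), 2 + s, 3 + s)%N | s <- iota 1 N] x =
    if (k < 2)%N then
      if (odd x == odd k) && (4 - k <= x <= N + 2)%N then x.+1
      else if (odd x != odd k) && (5 - k <= x <= N + 3)%N then x.-1 else x
    else x.
Proof.
rewrite /swap_edges; elim: N => [|N IH].
  by case: ifP => // k2; case: ifP; [lia | case: ifP => //; lia].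
rewrite -[N.+1]addn1 iotaD map_cat foldl_cat {}IH /= /swap.
by case: (boolP (odd (1 + N))) => oN; case: k => [|[|k]] /=; ifs.
Qed.

End Action.

Section Graph.
Variables (L r : nat).
Local Notation n := (L + 2 * r)%N.

(** Closed form of the action, as a cascade of intervals that linear arithmetic can decide. Labels 0
    and 1 alternate along the path 0, ..., L + 3, hence the parity rules; the jumps by [r - 2] are
    the rungs, since z_k - y_k = r - 2 as numbers. *)
Definition vmap (k x : nat) : nat :=
  if k == 0%N then if (x < L + 3)%N then if odd x then x - 1 else x + 1 else x
  else if k == 1%N then
    if (x < 1)%N then x else if (x < L + 4)%N then if odd x then x + 1 else x - 1 else x
  else if k == 2%N then
    if (x < 2)%N then x else if (x < 3)%N then 3 else if (x < 4)%N then 2 else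
    if (x < L + 3)%N then x else if (x < L + 4)%N then x + 1 else
    if (x < L + 5)%N then x - 1 else x
  else if (x < L + 1 + k)%N then x else if (x < L + 2 + k)%N then x + 1
  else if (x < L + 3 + k)%N then x - 1
  else if k == r - 3 then
    if (x < L + r + 2)%N then x + (r - 2) else if (x < L + 2 * r - 4)%N then x else
    if (x < L + 2 * r - 3)%N then x + 1 else if (x < L + 2 * r - 2)%N then x - 1 else x - (r - 2)
  else if (x < L + r + k - 1)%N then x else if (x < L + r + k)%N then x + 1
  else if (x < L + r + k + 1)%N then x - 1 else x.

Hypotheses (oddL : odd L) (L5 : (5 <= L)%N) (r7 : (7 <= r)%N).

Lemma edges_in : all (fun e => (e.1.2 < n)%N && (e.2 < n)%N) (edges n r).
Proof.
rewrite /edges /= addnK !all_cat /= !all_map.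
have -> : (0 < n)%N && (1 < n)%N = true by lia.
repeat (apply/andP; split); try lia; apply/allP=> s; rewrite mem_iota /=; lia.
Qed.

Lemma rho_vmap k (x : 'I_n) : (k < r)%N -> rho n r k x = vmap k x :> nat.
Proof.
move=> kr; rewrite (rho_swap_edges _ _ edges_in).
move: {x}(nat_of_ord x) (ltn_ord x) => x xn; rewrite /edges addnK.
rewrite !swap_edges_cat swap_edges_path !swap_edges_iota {1 3}/swap_edges.
rewrite [foldl _ x _]/= [foldl]lock /=  -lock /vmap.
case: k kr => [|[|[|k]]] kr.
- rewrite /swap /=; ifs.
- rewrite /swap /=; ifs.
- rewrite /swap /=; ifs.
rewrite /swap /=; ifs.
Qed.

Lemma odd_perm_transp a b : (a < n)%N -> (b < n)%N -> a != b -> odd_perm (transp n a b).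
Proof.
move=> an bn ab; rewrite /transp; case: insubP => [u _ ua|]; last by rewrite an.
case: insubP => [v _ vb|]; last by rewrite bn.
by rewrite odd_tperm -val_eqE /= ua vb.
Qed.

Lemma edges_neq : all (fun e => e.1.2 != e.2) (edges n r).
Proof.
rewrite /edges /= addnK !all_cat /= !all_map.
by repeat (apply/andP; split); try lia; apply/allP=> s; rewrite mem_iota /=; lia.
Qed.

Lemma odd_perm_rho k : odd_perm (rho n r k) = odd (count (fun e => e.1.1 == k) (edges n r)).
Proof.
rewrite /rho; elim: (edges n r) edges_in edges_neq => [|e es IH] /=; first by rewrite odd_perm1.
case/andP=> /andP[e1 e2] /IH {}IH /andP[e12 /IH {}IH]; case: eqP => _; last by rewrite IH.
by rewrite odd_permM IH odd_perm_transp // oddD.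
Qed.

Lemma count_path k t : count (fun s => (if odd s then 1 else 0)%N == k) (iota 1 (4 * t + 1)) =
  (if k == 0 then 2 * t else if k == 1 then 2 * t + 1 else 0)%N.
Proof.
elim: t => [|t IH]; first by case: k => [|[|k]].
rewrite (_ : 4 * t.+1 + 1 = 4 * t + 1 + 4)%N; last lia.
have om : odd (1 + (4 * t + 1)) = false by lia.
rewrite iotaD count_cat {}IH; move: (1 + (4 * t + 1))%N om => m om; rewrite /= om /=.
by case: k => [|[|k]] /=; lia.
Qed.

(** Labels 0 and 1 have 2t + 2 edges each, label [r - 3] has four, and every other label has two.
    For labels 0 and 1 this rests on [L] being 1 modulo 4. *)
Lemma rho_vmap_even k t : L = (4 * t + 1)%N -> (k < r)%N -> ~~ odd_perm (rho n r k).
Proof.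
move=> Lt kr; rewrite odd_perm_rho /edges addnK !count_cat !count_map.
have cnt m d : count (fun l => l == k) (iota m d) = (m <= k < m + d)%N :> nat.
  by rewrite -[LHS]/(count_mem k (iota m d)) count_uniq_mem ?iota_uniq // mem_iota.
rewrite {1}Lt (eq_count (a2 := fun s => (if odd s then 1 else 0)%N == k)) // count_path.
rewrite (eq_count (a2 := fun l => l == k)) // cnt (eq_count (a2 := fun l => l == k)) // cnt /=.
by case: k kr {cnt} => [|[|[|k]]] kr /=; lia.
Qed.

End Graph.

Section StringGroup.
Variables (L r : nat).
Local Notation n := (L + 2 * r)%N.
Hypotheses (oddL : odd L) (L5 : (5 <= L)%N) (r7 : (7 <= r)%N).
Local Notation vmap := (@vmap L r).
(** From here on the generators are known only through [vmap] and their parity, so the edge list is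
    never unfolded again. *)
Variable rho : nat -> {perm 'I_n}.
Hypothesis rhoE : forall k (x : 'I_n), (k < r)%N -> rho k x = vmap k x :> nat.
Hypothesis rho_even : forall k, (k < r)%N -> ~~ odd_perm (rho k).

(** * Relations between the generators *)

Lemma perm_nat_eq (p q : {perm 'I_n}) : (forall x, p x = q x :> nat) -> p = q.
Proof. by move=> E; apply/permP=> x; apply: val_inj; apply: E. Qed.

Lemma rhoK k : (k < r)%N -> rho k * rho k = 1.
Proof.
move=> kr; apply: perm_nat_eq => x; rewrite permM perm1 !rhoE //.
move: {x}(nat_of_ord x) (ltn_ord x) => x xn.
by case: k kr => [|[|[|k]]] kr; rewrite /vmap /=; ifs.
Qed.

Lemma rho_moves k : (k < r)%N -> exists x : 'I_n, rho k x != x.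
Proof.
move=> kr; pose y := if (k < 3)%N then k else (L + 1 + k)%N.
have yn : (y < n)%N by rewrite /y; ifs.
exists (Ordinal yn); rewrite -val_eqE /= rhoE //= /y /vmap.
by case: k kr {y yn} => [|[|[|k]]] kr /=; ifs.
Qed.

Lemma vmap_id k x : (2 < k)%N -> k != r - 3 ->
  (x < L + 1 + k)%N || (L + 3 + k <= x < L + r + k - 1)%N || (L + r + k + 1 <= x)%N ->
  vmap k x = x.
Proof.
case: k => [|[|[|k]]] // _ /negbTE kr xk; rewrite /vmap kr /=.
by case/orP: xk => [/orP[]|] xk; ifs.
Qed.

Lemma vmap_up k x : (2 < k < r)%N -> (x == L + 1 + k)%N || (x == L + r + k - 1)%N ->
  vmap k x = (x + 1)%N.
Proof.
by case: k => [|[|[|k]]] // kr /orP[] /eqP->; rewrite /vmap /=; ifs.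
Qed.

Lemma vmap_dn k x : (2 < k < r)%N -> (x == L + 2 + k)%N || (x == L + r + k)%N ->
  vmap k x = (x - 1)%N.
Proof.
by case: k => [|[|[|k]]] // kr /orP[] /eqP->; rewrite /vmap /=; ifs.
Qed.

Lemma vmap_tid x : (x < L + r - 2)%N || (L + r + 2 <= x < L + 2 * r - 4)%N ->
  vmap (r - 3) x = x.
Proof.
move=> xk; have [k Ek] : exists k, (r - 3)%N = k.+3 by exists (r - 6)%N; nat_lia.
rewrite /vmap Ek [_.+3 == 0%N]/= [_.+3 == 1%N]/= [_.+3 == 2%N]/= eqxx.
by case/orP: xk => xk; ifs.
Qed.

Lemma vmap_tup x : (x == L + r)%N || (x == L + r + 1)%N -> vmap (r - 3) x = (x + (r - 2))%N.
Proof.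
move=> xk; have [k Ek] : exists k, (r - 3)%N = k.+3 by exists (r - 6)%N; nat_lia.
rewrite /vmap Ek [_.+3 == 0%N]/= [_.+3 == 1%N]/= [_.+3 == 2%N]/= eqxx.
by ifs.
Qed.

Lemma vmap_tdn x : (x == L + 2 * r - 2)%N || (x == L + 2 * r - 1)%N ->
  vmap (r - 3) x = (x - (r - 2))%N.
Proof.
move=> xk; have [k Ek] : exists k, (r - 3)%N = k.+3 by exists (r - 6)%N; nat_lia.
rewrite /vmap Ek [_.+3 == 0%N]/= [_.+3 == 1%N]/= [_.+3 == 2%N]/= eqxx.
by ifs.
Qed.

(** Rewrites an innermost [vmap] whose case is settled by arithmetic. Relations between generators
    are thus checked by splitting the vertices into finitely many regions and evaluating from the
    inside out. *)
Ltac ev1 :=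
  match goal with |- context [vmap ?k ?x] =>
    lazymatch x with context [vmap _ _] => fail | _ =>
    first [ rewrite (_ : vmap k x = x); [|first [by apply: vmap_tid; nat_lia | by apply: vmap_id;
      nat_lia]]
    | rewrite (_ : vmap k x = x + 1)%N; [|by apply: vmap_up; nat_lia]
    | rewrite (_ : vmap k x = x - 1)%N; [|by apply: vmap_dn; nat_lia]
    | rewrite (_ : vmap k x = x + (r - 2))%N; [|by apply: vmap_tup; nat_lia]
    | rewrite (_ : vmap k x = x - (r - 2))%N; [|by apply: vmap_tdn; nat_lia] ] end end.
Ltac ev := repeat ev1; try nat_lia.

Ltac regions x := let H := fresh "H" in intro H;
  repeat match type of H with _ \/ _ => destruct H as [H|H] end; try subst x.
Lemma vmap_low k x : (k < 3)%N -> (L + 3 + k <= x)%N || (L + 4 < x)%N -> vmap k x = x.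
Proof. by case: k => [|[|[|]]] // _ xL; rewrite /vmap /=; ifs. Qed.

Lemma disjoint_commute (p q : {perm 'I_n}) :
  (forall x, p x = x :> nat \/ q x = x :> nat) -> commute p q.
Proof.
move=> D; apply: (@perm_onC _ [set x | p x != x] [set x | q x != x]).
- by apply/subsetP=> x; rewrite !inE.
- by apply/subsetP=> x; rewrite !inE.
rewrite -setI_eq0; apply/eqP/setP=> x; rewrite !inE -!val_eqE.
by case: (D x) => /= ->; rewrite eqxx ?andbF.
Qed.

(** The supports are disjoint except for two pairs of labels: 0 and 2 share the edge p_3 p_4, and
    [r - 3] and [r - 1] form the square y_(r-1), y_r, z_r, z_(r-1). These two are checked vertex by
    vertex. *)
Lemma rho_commute i j : (i.+2 <= j)%N -> (j < r)%N -> commute (rho i) (rho j).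
Proof.
move=> ij jr; have [Ei|ni] := eqVneq i (r - 3)%N.
  have Ej : j = (r - 1)%N by nat_lia.
  apply: perm_nat_eq => x; rewrite !permM !rhoE //; try nat_lia.
  rewrite Ei Ej; move: {x}(nat_of_ord x) (ltn_ord x) => x xn.
  have : (x < L + r - 2 \/ x = L + r - 2 \/ x = L + r - 1 \/ x = L + r \/ x = L + r + 1 \/
    L + r + 2 <= x < L + 2 * r - 4 \/ x = L + 2 * r - 4 \/ x = L + 2 * r - 3 \/
    x = L + 2 * r - 2 \/ x = L + 2 * r - 1)%N by nat_lia.
  by regions x; ev.
have [j3|j3] := ltnP 2 j; last first.
  apply: perm_nat_eq => x; rewrite !permM !rhoE //; try nat_lia.
  have [-> ->] : i = 0 /\ j = 2 by nat_lia.
  by move: {x}(nat_of_ord x) (ltn_ord x) => x xn; rewrite /vmap /=; ifs.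
apply: disjoint_commute => x; rewrite !rhoE //; last nat_lia.
move: {x}(nat_of_ord x) (ltn_ord x) => x xn.
have [i3|i3] := ltnP i 3.
  have [xL|xL] := leqP (L + 1 + j) x; [left; rewrite vmap_low //; nat_lia | right].
  by have [Ej|nj] := eqVneq j (r - 3)%N; [rewrite Ej|]; ev.
have : (x = L + 1 + i \/ x = L + 2 + i \/ x = L + r + i - 1 \/ x = L + r + i \/
  ((x < L + 1 + i)%N || (L + 3 + i <= x < L + r + i - 1)%N || (L + r + i + 1 <= x)%N))%N by nat_lia.
have [Ej|nj] := eqVneq j (r - 3)%N.
  by rewrite Ej; regions x; try (by right; ev); left; ev.
by regions x; try (by right; ev); left; ev.
Qed.

Lemma braid_expg3 a : (3 <= a)%N -> (a.+1 < r)%N -> a != r - 4 -> a != r - 3 ->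
  (rho a * rho a.+1) ^+ 3 = 1.
Proof.
move=> a3 ar a4 a5; apply: perm_nat_eq => x; rewrite !expgS expg0 mulg1 perm1 !permM !rhoE //;
  try nat_lia.
move: {x}(nat_of_ord x) (ltn_ord x) => x xn.
have : ((x < L + 1 + a)%N || (L + 4 + a <= x < L + r + a - 1)%N || (L + r + a + 2 <= x)%N \/
     x = L + 1 + a \/ x = L + 2 + a \/ x = L + 3 + a \/ x = L + r + a - 1 \/
     x = L + r + a \/ x = L + r + a + 1)%N by nat_lia.
case; first by move=> xa; rewrite !vmap_id //; nat_lia.
by regions x; ev.
Qed.

Definition vtau (x : nat) : nat := if (x < L + r)%N then x else if (x < L + r + 2)%N then
  (x + (r - 2))%N
  else if (x < L + 2 * r - 2)%N then x else (x - (r - 2))%N.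

Lemma vtau_id x : (x < L + r)%N || (L + r + 2 <= x < L + 2 * r - 2)%N -> vtau x = x.
Proof. by rewrite /vtau => /orP[] ?; ifs. Qed.

Lemma vtau_up x : (L + r <= x < L + r + 2)%N -> vtau x = (x + (r - 2))%N.
Proof. by rewrite /vtau => ?; ifs. Qed.

Lemma vtau_dn x : (L + 2 * r - 2 <= x)%N -> vtau x = (x - (r - 2))%N.
Proof. by rewrite /vtau => ?; ifs. Qed.

Definition vflip4 (x : nat) : nat := if (x < L + r - 2)%N then x else if (x < L + r + 2)%N then
  (x + (r - 2))%N
  else if (x < L + 2 * r - 4)%N then x else (x - (r - 2))%N.

Lemma vflip4_id x : (x < L + r - 2)%N || (L + r + 2 <= x < L + 2 * r - 4)%N -> vflip4 x = x.
Proof. by rewrite /vflip4 => /orP[] ?; ifs. Qed.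

Lemma vflip4_up x : (L + r - 2 <= x < L + r + 2)%N -> vflip4 x = (x + (r - 2))%N.
Proof. by rewrite /vflip4 => ?; ifs. Qed.

Lemma vflip4_dn x : (L + 2 * r - 4 <= x)%N -> vflip4 x = (x - (r - 2))%N.
Proof. by rewrite /vflip4 => ?; ifs. Qed.

Ltac evt1 := 
  match goal with
  | |- context [vtau ?x] =>
    lazymatch x with context [vmap _ _] => fail | context [vtau _] => fail | _ =>
    first [ rewrite (_ : vtau x = x); [|by apply: vtau_id; nat_lia]
    | rewrite (_ : vtau x = x + (r - 2))%N; [|by apply: vtau_up; nat_lia]
    | rewrite (_ : vtau x = x - (r - 2))%N; [|by apply: vtau_dn; nat_lia] ] end
  | |- context [vflip4 ?x] =>
    lazymatch x with context [vmap _ _] => fail | context [vflip4 _] => fail | _ =>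
    first [ rewrite (_ : vflip4 x = x); [|by apply: vflip4_id; nat_lia]
    | rewrite (_ : vflip4 x = x + (r - 2))%N; [|by apply: vflip4_up; nat_lia]
    | rewrite (_ : vflip4 x = x - (r - 2))%N; [|by apply: vflip4_dn; nat_lia] ] end
  end.
Ltac evt := do ?[evt1 | ev1]; try nat_lia.

(* [tau] is (y_(r-1) z_(r-1)) (y_r z_r), and [flip4] exchanges y_k and z_k for r - 3 <= k <= r. *)
Definition tau := (rho (r - 4) * rho (r - 3)) ^+ 3.

Lemma tauE (x : 'I_n) : tau x = vtau x :> nat.
Proof.
rewrite /tau !expgS expg0 mulg1 !permM !rhoE //; try nat_lia.
move: {x}(nat_of_ord x) (ltn_ord x) => x xn.
have : (x < L + 1 + (r - 4) \/ x = L + 1 + (r - 4) \/ x = L + 2 + (r - 4) \/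
  x = L + 3 + (r - 4) \/ x = L + r \/ x = L + r + 1 \/
  L + r + 2 <= x < L + 2 * r - 5 \/ x = L + 2 * r - 5 \/ x = L + 2 * r - 4 \/ x = L + 2 * r - 3 \/
  x = L + 2 * r - 2 \/ x = L + 2 * r - 1)%N by nat_lia.
by regions x; evt.
Qed.

Definition flip4 := (rho (r - 3) * rho (r - 2)) ^+ 3.

Lemma flip4E (x : 'I_n) : flip4 x = vflip4 x :> nat.
Proof.
rewrite /flip4 !expgS expg0 mulg1 !permM !rhoE //; try nat_lia.
move: {x}(nat_of_ord x) (ltn_ord x) => x xn.
have : (x < L + r - 2 \/ x = L + r - 2 \/ x = L + r - 1 \/ x = L + r \/ x = L + r + 1 \/
  L + r + 2 <= x < L + 2 * r - 4 \/ x = L + 2 * r - 4 \/ x = L + 2 * r - 3 \/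
  x = L + 2 * r - 2 \/ x = L + 2 * r - 1)%N by nat_lia.
by regions x; evt.
Qed.

Lemma tauK : tau * tau = 1.
Proof.
move: tau tauE => t tE; apply: perm_nat_eq => x; rewrite permM perm1 !tE.
by move: {x}(nat_of_ord x) (ltn_ord x) => x xn; rewrite /vtau; ifs.
Qed.

Lemma flip4K : flip4 * flip4 = 1.
Proof.
move: flip4 flip4E => f fE; apply: perm_nat_eq => x; rewrite permM perm1 !fE.
by move: {x}(nat_of_ord x) (ltn_ord x) => x xn; rewrite /vflip4; ifs.
Qed.

(** [flip4] flips both of the blocks that [rho (r - 1)] exchanges. *)
Lemma flip4_commute : commute (rho (r - 1)) flip4.
Proof.
move: flip4 flip4E => f fE; apply: perm_nat_eq => x; rewrite !permM !(fE, rhoE) //; try nat_lia.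
move: {x}(nat_of_ord x) (ltn_ord x) => x xn.
have : (x < L + r - 2 \/ x = L + r - 2 \/ x = L + r - 1 \/ x = L + r \/ x = L + r + 1 \/
  L + r + 2 <= x < L + 2 * r - 4 \/ x = L + 2 * r - 4 \/ x = L + 2 * r - 3 \/
  x = L + 2 * r - 2 \/ x = L + 2 * r - 1)%N by nat_lia.
by regions x; evt.
Qed.

(** Both sides flip exactly the blocks r - 2 and r - 1: on the right, flips of {r - 1, r} and {r -
    2, r} are multiplied and the flip of block r cancels. The point is that [rho (r - 1)] has
    disappeared. *)
Lemma tau_conj : rho (r - 1) * rho (r - 2) * tau * (rho (r - 2) * rho (r - 1)) =
  tau * (rho (r - 2) * tau * rho (r - 2)).
Proof.
move: tau tauE => t tE; apply: perm_nat_eq => x; rewrite !permM !(tE, rhoE) //; try nat_lia.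
move: {x}(nat_of_ord x) (ltn_ord x) => x xn.
have : (x < L + r - 1 \/ x = L + r - 1 \/ x = L + r \/ x = L + r + 1 \/
  L + r + 2 <= x < L + 2 * r - 3 \/ x = L + 2 * r - 3 \/
  x = L + 2 * r - 2 \/ x = L + 2 * r - 1)%N by nat_lia.
by regions x; evt.
Qed.

Lemma tau_commute a : (a <= r - 4)%N -> commute tau (rho a).
Proof.
move=> ar; move: tau tauE => t tE; apply: disjoint_commute => x; rewrite !(tE, rhoE) //;
  try nat_lia.
move: {x}(nat_of_ord x) (ltn_ord x) => x xn.
have : ((x < L + r)%N || (L + r + 2 <= x < L + 2 * r - 2)%N \/ L + r <= x < L + r + 2 \/
  L + 2 * r - 2 <= x)%N by nat_lia.
case=> [xr|xr]; [by left; apply: vtau_id|right]. have [a3|a3] := ltnP a 3; [rewrite vmap_low //;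
  nat_lia | ev].
Qed.

Lemma expg3V (gT : finGroupType) (a b : gT) : a * a = 1 -> b * b = 1 ->
  (b * a) ^+ 3 = ((a * b) ^+ 3)^-1.
Proof.
by move=> a2 b2; rewrite -expgVn invMg;
  have [-> ->] : a^-1 = a /\ b^-1 = b by split; apply/eqP; rewrite eq_invg_mul; apply/eqP.
Qed.

Lemma tau_commute_rev : commute tau (rho (r - 3)).
Proof.
move: tau tauE => t tE; apply: perm_nat_eq => x; rewrite !permM !(tE, rhoE) //; try nat_lia.
move: {x}(nat_of_ord x) (ltn_ord x) => x xn.
have : (x < L + r - 2 \/ x = L + r - 2 \/ x = L + r - 1 \/ x = L + r \/ x = L + r + 1 \/
  L + r + 2 <= x < L + 2 * r - 4 \/ x = L + 2 * r - 4 \/ x = L + 2 * r - 3 \/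
  x = L + 2 * r - 2 \/ x = L + 2 * r - 1)%N by nat_lia.
by regions x; evt.
Qed.

Lemma rho_sggi : sggi r rho.
Proof.
split=> [i ir|i j ir jr ij].
  apply: nt_prime_order => //; first by rewrite expg2 rhoK.
  by have [x] := rho_moves ir; apply: contraNneq => ->; rewrite perm1.
have C : commute (rho i) (rho j).
  by case: ij => ij; [|apply: commute_sym]; apply: rho_commute.
by rewrite expgMn // !expg2 !rhoK ?mulg1.
Qed.

(** * Alternating groups generated by 3-cycles *)

Local Notation GG i j := (@itv_gen _ r rho i j).
Definition vset (P : pred nat) : {set 'I_n} := [set x : 'I_n | P x].

Lemma alt_inS (P P' : pred nat) (H H' : {group {perm 'I_n}}) :
  (forall y, (y < n)%N -> P' y -> P y) -> H \subset H' ->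
  alt_in (vset P) H -> alt_in (vset P') H'.
Proof.
move=> sP /subsetP sH altP g gP' ge; apply/sH/altP => //.
by apply: perm_onS gP'; apply/subsetP=> x; rewrite !inE; apply: sP.
Qed.

Lemma GG_S i j i' j' : (i' <= i)%N -> (j <= j')%N -> GG i j \subset GG i' j'.
Proof. by move=> ii jj; apply/gen_byS/itv_setS. Qed.

Lemma mem_GG i j k : (i <= k < j)%N -> (k < r)%N -> rho k \in GG i j.
Proof. exact: itv_gen_mem. Qed.

(** [a] and [b] are spectators: two vertices of the current support fixed by the generator that
    carries [x] to the new vertex [u]. *)
Lemma alt_grow (P P' : pred nat) (H : {group {perm 'I_n}}) k (x a b u : nat) :
  (k < r)%N -> (x < n)%N -> (a < n)%N -> (b < n)%N ->
  alt_in (vset P) H -> rho k \in H -> P x -> P a -> P b ->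
  a != b -> a != x -> b != x -> vmap k x = u -> vmap k a = a -> vmap k b = b ->
  (forall y, (y < n)%N -> P' y -> P y || (y == u)) -> alt_in (vset P') H.
Proof.
move=> kr xn an bn altP kH Px Pa Pb ab ax bx kx ka kb sP.
have fixk c (cn : (c < n)%N) : vmap k c = c -> rho k (Ordinal cn) = Ordinal cn.
  by move=> E; apply: val_inj; rewrite /= rhoE.
have := @alt_in_step _ (vset P) H (rho k) (Ordinal xn) (Ordinal an) (Ordinal bn) altP kH.
rewrite !inE -!val_eqE /= Px Pa Pb ab ax bx (fixk _ an ka) (fixk _ bn kb) =>
  /(_ isT isT isT isT isT isT erefl erefl).
move=> altP' g gP' ge; apply: altP' => //; apply: perm_onS gP'; apply/subsetP=> y.
by rewrite !inE -val_eqE /= rhoE //= kx => /sP -/(_ (ltn_ord y)) /orP[] ->; rewrite ?orbT.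
Qed.

Lemma tperm_nat m (a b x : 'I_m) : tperm a b x = swap a b x :> nat.
Proof.
rewrite /swap; case: tpermP => [->|->|/eqP xa /eqP xb]; rewrite ?eqxx //.
  by case: eqP => // /val_inj->.
by rewrite -!val_eqE /= in xa xb; rewrite (negbTE xa) (negbTE xb).
Qed.

Lemma alt_in_cycle3_nat (P P' : pred nat) (H : {group {perm 'I_n}}) (g : {perm 'I_n}) (a b u : nat) :
  (a < n)%N -> (b < n)%N -> (u < n)%N -> alt_in (vset P) H -> g \in H ->
  P a -> P b -> ~~ P u -> a != b -> u != a -> u != b ->
  (forall x : 'I_n, g x = swap a u (swap a b x) :> nat) ->
  (forall y, (y < n)%N -> P' y -> P y || (y == u)) -> alt_in (vset P') H.
Proof.
move=> an bn un altP gH Pa Pb Pu ab ua ub gE sP.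
have := @alt_in_cycle3 _ (vset P) H (Ordinal an) (Ordinal bn) (Ordinal un) altP.
rewrite !inE -!val_eqE /= Pa Pb Pu => /(_ isT isT ab isT).
have -> : tperm (Ordinal an) (Ordinal bn) * tperm (Ordinal an) (Ordinal un) = g.
  by apply: perm_nat_eq => x; rewrite permM !tperm_nat gE.
move=> /(_ gH) altP' h hP' he; apply: altP' => //; apply: perm_onS hP'; apply/subsetP=> y.
by rewrite !inE -val_eqE /= => /sP -/(_ (ltn_ord y)) /orP[] ->; rewrite ?orbT.
Qed.

Lemma vmap0_id (x : nat) : (L + 3 <= x)%N -> vmap 0 x = x.
Proof. by rewrite /vmap /= => ?; ifs. Qed.

Lemma vmap0_up (x : nat) : ~~ odd x && (x < L + 3)%N -> vmap 0 x = (x + 1)%N.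
Proof. by rewrite /vmap /= => ?; ifs. Qed.

Lemma vmap0_dn (x : nat) : odd x && (x < L + 3)%N -> vmap 0 x = (x - 1)%N.
Proof. by rewrite /vmap /= => ?; ifs. Qed.

Lemma vmap1_id (x : nat) : (x == 0)%N || (L + 4 <= x)%N -> vmap 1 x = x.
Proof. by rewrite /vmap /= => ?; ifs. Qed.

Lemma vmap1_up (x : nat) : odd x && (x < L + 4)%N -> vmap 1 x = (x + 1)%N.
Proof. by rewrite /vmap /= => ?; ifs. Qed.

Lemma vmap1_dn (x : nat) : ~~ odd x && (0 < x < L + 4)%N -> vmap 1 x = (x - 1)%N.
Proof. by rewrite /vmap /= => ?; ifs. Qed.

Lemma vmap2_id (x : nat) : (x < 2)%N || (4 <= x < L + 3)%N || (L + 5 <= x)%N -> vmap 2 x = x.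
Proof. by rewrite /vmap /= => ?; ifs. Qed.

Lemma vmap2_up (x : nat) : ((x == 2) || (x == L + 3))%N -> vmap 2 x = (x + 1)%N.
Proof. by rewrite /vmap /= => ?; ifs. Qed.

Lemma vmap2_dn (x : nat) : ((x == 3) || (x == L + 4))%N -> vmap 2 x = (x - 1)%N.
Proof. by rewrite /vmap /= => ?; ifs. Qed.

Ltac evl1 :=
  match goal with
  | |- context [vmap 0 ?x] =>
    lazymatch x with context [vmap _ _] => fail | _ =>
    first [ rewrite (_ : vmap 0 x = x); [|by apply: vmap0_id; nat_lia]
    | rewrite (_ : vmap 0 x = x + 1)%N; [|by apply: vmap0_up; nat_lia]
    | rewrite (_ : vmap 0 x = x - 1)%N; [|by apply: vmap0_dn; nat_lia] ] end
  | |- context [vmap 1 ?x] =>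
    lazymatch x with context [vmap _ _] => fail | _ =>
    first [ rewrite (_ : vmap 1 x = x); [|by apply: vmap1_id; nat_lia]
    | rewrite (_ : vmap 1 x = x + 1)%N; [|by apply: vmap1_up; nat_lia]
    | rewrite (_ : vmap 1 x = x - 1)%N; [|by apply: vmap1_dn; nat_lia] ] end
  | |- context [vmap 2 ?x] =>
    lazymatch x with context [vmap _ _] => fail | _ =>
    first [ rewrite (_ : vmap 2 x = x); [|by apply: vmap2_id; nat_lia]
    | rewrite (_ : vmap 2 x = x + 1)%N; [|by apply: vmap2_up; nat_lia]
    | rewrite (_ : vmap 2 x = x - 1)%N; [|by apply: vmap2_dn; nat_lia] ] end
  end.
Ltac evl := do ?[evl1 | evt1 | ev1]; try nat_lia.

(** [rho 1 * rho 2] is a 4-cycle on the vertices 1, ..., 4, a 3-cycle on L + 2, L + 3, L + 4, and of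
    order at most 2 elsewhere. Its square keeps two transpositions and the 3-cycle, its fourth power
    only the 3-cycle. *)
Definition v12 (x : nat) : nat := if (x < 1)%N then x else if (x < 5)%N then (5 - x)%N else
  if (x < L + 2)%N then x else if (x < L + 4)%N then (x + 1)%N else
  if (x < L + 5)%N then (x - 2)%N else x.

Lemma rho12_sqr (x : 'I_n) : ((rho 1 * rho 2) ^+ 2) x = v12 x :> nat.
Proof.
rewrite expg2 !permM !rhoE //; try nat_lia.
move: {x}(nat_of_ord x) (ltn_ord x) => x xn; rewrite /v12.
have : (x = 0 \/ x = 1 \/ x = 2 \/ x = 3 \/ x = 4 \/ 5 <= x < L + 2 \/ x = L + 2 \/ x = L + 3 \/
  x = L + 4 \/ L + 4 < x)%N by nat_lia.
regions x; try (by evl; ifs).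
by have [ox|ox] := boolP (odd x); evl; ifs.
Qed.

Lemma rho12_4 (x : 'I_n) :
  ((rho 1 * rho 2) ^+ 4) x = swap (L + 3) (L + 4) (swap (L + 3) (L + 2) x) :> nat.
Proof.
rewrite (expgM _ 2 2) [_ ^+ 2 ^+ 2]expg2 permM !rho12_sqr.
by move: {x}(nat_of_ord x) (ltn_ord x) => x xn; rewrite /v12 /swap; ifs.
Qed.

Lemma rho23_2 (x : 'I_n) :
  ((rho 2 * rho 3) ^+ 2) x = swap (L + 3) (L + 5) (swap (L + 3) (L + 4) x) :> nat.
Proof.
rewrite expg2 !permM !rhoE //; try nat_lia.
move: {x}(nat_of_ord x) (ltn_ord x) => x xn; rewrite /swap.
have : (x < 2 \/ x = 2 \/ x = 3 \/ 4 <= x < L + 3 \/ x = L + 3 \/ x = L + 4 \/ x = L + 5 \/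
  L + 5 < x < L + r + 2 \/ x = L + r + 2 \/ x = L + r + 3 \/ L + r + 3 < x)%N by nat_lia.
by regions x; evl; ifs.
Qed.

Local Notation itvP lo hi := [pred x : nat | (lo <= x < hi)%N].

Lemma mem_GG_mul i j (g h : {perm 'I_n}) m : g \in GG i j -> h \in GG i j ->
  (g * h) ^+ m \in GG i j.
Proof. by move=> gG hG; rewrite groupX ?groupM. Qed.

Lemma alt_in_pair (P : pred nat) u (H : {group {perm 'I_n}}) : (u.+1 < n)%N ->
  (forall y, P y -> y = u \/ y = u.+1) -> alt_in (vset P) H.
Proof.
move=> un uP; apply: alt_in_small.
apply: (leq_trans (n := #|[set Ordinal (ltnW un); Ordinal un]|)); last first.
  by rewrite cards2; case: eqP.
by apply/subset_leq_card/subsetP=> x; rewrite !inE -!val_eqE /= => /uP[]->; rewrite eqxx ?orbT.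
Qed.

Lemma alt_base2 : alt_in (vset (itvP (L + 3) (L + 6))) (GG 2 4).
Proof.
apply: (@alt_in_cycle3_nat (itvP (L + 3) (L + 5)) _ _ ((rho 2 * rho 3) ^+ 2)
  (L + 3) (L + 4) (L + 5)); try (rewrite /=; nat_lia).
- by apply: (alt_in_pair (u := L + 3)); [nat_lia | move=> y /=; nat_lia].
- by apply: mem_GG_mul; apply: mem_GG; nat_lia.
- exact: rho23_2.
Qed.

Lemma alt_base1 : alt_in (vset (itvP (L + 2) (L + 5))) (GG 1 3).
Proof.
apply: (@alt_in_cycle3_nat (itvP (L + 2) (L + 4)) _ _ ((rho 1 * rho 2) ^+ 4)
  (L + 3) (L + 2) (L + 4)); try (rewrite /=; nat_lia).
- by apply: (alt_in_pair (u := L + 2)); [nat_lia | move=> y /=; nat_lia].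
- by apply: mem_GG_mul; apply: mem_GG; nat_lia.
- exact: rho12_4.
Qed.

Lemma alt_base13 : alt_in (vset (itvP (L + 2) (L + 6))) (GG 1 4).
Proof.
have A := alt_inS (fun _ _ h => h) (GG_S (leqnn 1) (leqnSn 3)) alt_base1.
apply: (@alt_grow _ _ _ 3 (L + 4) (L + 2) (L + 3) (L + 5) _ _ _ _ A); try (rewrite /=; nat_lia).
- by apply: mem_GG; nat_lia.
- by ev.
- by ev.
- by ev.
Qed.

(** Used twice, with [lo = L + 2], [i = 1] and with [lo = L + 3], [i = 2]: the vertex L + 2 =
    q_(L-1) is joined to y_2 by label 1 only. *)
Section Grow.
Variables (lo i : nat).
Hypotheses (loL : (L < lo <= L + 3)%N) (i2 : (i <= 2)%N).
Hypothesis base : alt_in (vset (itvP lo (L + 6))) (GG i 4).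

Lemma grow_y m : (3 <= m <= r - 3)%N -> alt_in (vset (itvP lo (L + 3 + m))) (GG i m.+1).
Proof.
case/andP; elim: m => // m IH m3 mr.
have [Em|lt_m] := eqVneq m.+1 3; first by rewrite Em (_ : L + 3 + 3 = L + 6)%N; [apply: base |
  nat_lia].
have A := alt_inS (fun _ _ h =>
  h) (GG_S (leqnn i) (leqnSn m.+1)) (IH ltac:(nat_lia) ltac:(nat_lia)).
apply: (@alt_grow _ _ _ m.+1 (L + m + 2) (L + 3) (L + 4) (L + m + 3) _ _ _ _ A); try (rewrite /=;
  nat_lia).
- by apply: mem_GG; nat_lia.
- by ev.
- by have [->|] := eqVneq m.+1 (r - 3)%N => [|?]; ev.
- by have [->|] := eqVneq m.+1 (r - 3)%N => [|?]; ev.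
Qed.

Definition yzP m := [pred x : nat | (lo <= x < L + r + 1)%N || (m <= x < L + 2 * r - 1)%N].

(** The z chain is entered at its far end: the rung leads from y_(r-1) to z_(r-1), and the labels r
    - 2, ..., 3 then descend to z_3. *)
Lemma grow_z d : (d <= r - 4)%N -> alt_in (vset (yzP (L + 2 * r - 2 - d))) (GG i (r - 1)).
Proof.
elim: d => [_|d IH dr].
  have A := alt_inS (fun _ _ h =>
    h) (GG_S (leqnn i) (leqnSn (r - 3).+1)) (@grow_y (r - 3) ltac:(nat_lia)).
  rewrite (_ : (r - 3).+2 = r - 1)%N in A; last nat_lia.
  have B : alt_in (vset (itvP lo (L + r + 1))) (GG i (r - 1)).
    apply: (@alt_grow _ _ _ (r - 2) (L + r - 1) (L + 3) (L + 4) (L + r) _ _ _ _ A);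
      try (rewrite /=; nat_lia).
    - by apply: mem_GG; nat_lia.
    - by ev.
    - by ev.
    - by ev.
  apply: (@alt_grow _ _ _ (r - 3) (L + r) (L + 3) (L + 4) (L + 2 * r - 2) _ _ _ _ B);
    try (rewrite /=; nat_lia).
  - by apply: mem_GG; nat_lia.
  - by ev.
  - by ev.
  - by ev.
have {IH} A := IH (ltnW dr).
(* The spectator y_3 = L + 4 is moved by [rho 3], so the last step takes y_5 = L + 6 instead. *)
have [E3|ne3] := eqVneq (r - 2 - d)%N 3.
  apply: (@alt_grow _ _ _ 3 (L + 2 * r - 2 - d) (L + 3) (L + 6) (L + 2 * r - 3 - d) _ _ _ _ A);
   try (rewrite /=; nat_lia).
  - by apply: mem_GG; nat_lia.
  - by ev.
  - by ev.
  - by ev.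
apply: (@alt_grow _ _ _ (r - 2 - d) (L + 2 * r - 2 - d) (L + 3) (L + 4) (L + 2 * r - 3 - d) _ _ _ _ A);
  try (rewrite /=; nat_lia).
- by apply: mem_GG; nat_lia.
- by ev.
- by have [->|] := eqVneq (r - 2 - d)%N (r - 3)%N => [|?]; ev.
- by have [->|] := eqVneq (r - 2 - d)%N (r - 3)%N => [|?]; ev.
Qed.

Lemma grow_full : alt_in (vset (itvP lo n)) (GG i r).
Proof.
have A := @grow_z (r - 4) (leqnn _).
have sG : GG i (r - 1) \subset GG i r by apply: GG_S; nat_lia.
have {sG} A := alt_inS (fun _ _ h => h) sG A.
have B : alt_in (vset [pred x : nat | (lo <= x < L + 2 * r - 1)%N]) (GG i r).
  apply: (@alt_grow _ _ _ (r - 1) (L + r) (L + 3) (L + 4) (L + r + 1) _ _ _ _ A);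
    try (rewrite /=; nat_lia).
  - by apply: mem_GG; nat_lia.
  - by ev.
  - by ev.
  - by ev.
apply: (@alt_grow _ _ _ (r - 1) (L + 2 * r - 2) (L + 3) (L + 4) (L + 2 * r - 1) _ _ _ _ B);
  try (rewrite /=; nat_lia).
- by apply: mem_GG; nat_lia.
- by ev.
- by ev.
- by ev.
Qed.

End Grow.

Lemma alt_total : alt_in [set: 'I_n] (GG 0 r).
Proof.
have A : alt_in (vset (itvP (L + 2) n)) (GG 0 r).
  apply: alt_inS (grow_full _ _ alt_base13) => //; try nat_lia.
  by apply: GG_S; nat_lia.
suff B d : (d <= L + 2)%N -> alt_in (vset (itvP (L + 2 - d) n)) (GG 0 r).
  have := B (L + 2)%N (leqnn _); rewrite subnn => C g _ ge; apply: C => //.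
  by apply/subsetP=> x _; rewrite inE /=.
elim: d => [_|d IH dL]; first by rewrite subn0.
have {}A := IH (ltnW dL).
have [od|od] := boolP (odd (L + 1 - d)).
  apply: (@alt_grow _ _ _ 1 (L + 2 - d) (L + 5) (L + 6) (L + 1 - d) _ _ _ _ A); try (rewrite /=;
    nat_lia).
  - by apply: mem_GG; nat_lia.
  - by evl.
  - by evl.
  - by evl.
apply: (@alt_grow _ _ _ 0 (L + 2 - d) (L + 5) (L + 6) (L + 1 - d) _ _ _ _ A); try (rewrite /=;
  nat_lia).
- by apply: mem_GG; nat_lia.
- by evl.
- by evl.
- by evl.
Qed.

Lemma rho34_2 (x : 'I_n) : ((rho 3 * rho 4) ^+ 2) x =
  swap (L + 4) (L + 6) (swap (L + 4) (L + 5)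
    (swap (L + r + 2) (L + r + 4) (swap (L + r + 2) (L + r + 3) x))) :> nat.
Proof.
rewrite expg2 !permM !rhoE //; try nat_lia.
move: {x}(nat_of_ord x) (ltn_ord x) => x xn; rewrite /swap.
have : (x < L + 4 \/ x = L + 4 \/ x = L + 5 \/ x = L + 6 \/ L + 6 < x < L + r \/
  x = L + r \/ x = L + r + 1 \/
  x = L + r + 2 \/ x = L + r + 3 \/ x = L + r + 4 \/ L + r + 4 < x < L + 2 * r - 2 \/
  x = L + 2 * r - 2 \/ x = L + 2 * r - 1)%N by nat_lia.
have [E4|n4] := eqVneq 4 (r - 3)%N.
  by rewrite E4; regions x; evl; ifs.
by regions x; evl; ifs.
Qed.

Lemma swapK a b : involutive (swap a b).
Proof. by move=> x; rewrite /swap; ifs. Qed.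

(** Without [rho (r - 2)] the z vertices are not in the orbit of y_2, so growth cannot reach them.
    The square of [rho 3 * rho 4] is a pair of parallel 3-cycles, on y_3, y_4, y_5 and on z_3, z_4,
    z_5; the first lies in the group by [grow_y], hence so does the second. *)
Lemma alt_z : alt_in (vset (itvP (L + r + 2) (L + 2 * r - 2))) (GG 1 (r - 2)).
Proof.
have Y : alt_in (vset (itvP (L + 2) (L + r))) (GG 1 (r - 2)).
  have := grow_y (lo := L + 2) _ (i := 1) _ alt_base13 (m := r - 3).
  rewrite (_ : L + 3 + (r - 3) = L + r)%N; last nat_lia.
  by rewrite (_ : (r - 3).+1 = r - 2)%N; [apply; nat_lia | nat_lia].
have base : alt_in (vset (itvP (L + r + 2) (L + r + 5))) (GG 1 (r - 2)).
  have n4 : (L + 4 < n)%N by nat_lia.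
  have n5 : (L + 5 < n)%N by nat_lia.
  have n6 : (L + 6 < n)%N by nat_lia.
  pose c := tperm (Ordinal n4) (Ordinal n5) * tperm (Ordinal n4) (Ordinal n6).
  apply: (@alt_in_cycle3_nat (itvP (L + r + 2) (L + r + 4)) _ _ ((rho 3 * rho 4) ^+ 2 * c^-1)
    (L + r + 2) (L + r + 3) (L + r + 4)); try (rewrite /=; nat_lia).
  - by apply: (alt_in_pair (u := L + r + 2)); [nat_lia | move=> y /=; nat_lia].
  - rewrite groupM ?groupV //; first by apply: mem_GG_mul; apply: mem_GG; nat_lia.
    apply: Y; last by rewrite odd_permM !odd_tperm -!val_eqE /=; nat_lia.
    by rewrite perm_onM ?perm_on_tperm // inE /=; nat_lia.
  by move=> x; rewrite permM invMg !tpermV permM !tperm_nat rho34_2 /= !swapK.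
suff B d : (d <= r - 7)%N ->
    alt_in (vset (itvP (L + r + 2) (L + r + 5 + d))) (GG 1 (r - 2)).
  by have := B (r - 7)%N (leqnn _); rewrite (_ : L + r + 5 + (r - 7) = L + 2 * r - 2)%N //; nat_lia.
elim: d => [_|d IH dr]; first by rewrite addn0.
have {}A := IH (ltnW dr).
apply: (@alt_grow _ _ _ (d + 5) (L + r + 4 + d) (L + r + 2) (L + r + 3) (L + r + 5 + d) _ _ _ _ A);
  try (rewrite /=; nat_lia).
- by apply: mem_GG; nat_lia.
- by ev.
- by have [->|] := eqVneq (d + 5)%N (r - 3)%N => [|?]; ev.
- by have [->|] := eqVneq (d + 5)%N (r - 3)%N => [|?]; ev.
Qed.

(** * The Schlafli type *)

Lemma order_6 (gT : finGroupType) (g : gT) :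
  g ^+ 6 = 1 -> g ^+ 2 != 1 -> g ^+ 3 != 1 -> #[g] = 6.
Proof.
move=> /eqP; rewrite -!order_dvdn => d6.
have := dvdn_leq (isT : 0 < 6)%N d6; move: (order_gt0 g) d6.
by case: #[g] => [|[|[|[|[|[|[|]]]]]]].
Qed.

Lemma order_12 (gT : finGroupType) (g : gT) :
  g ^+ 12 = 1 -> g ^+ 4 != 1 -> g ^+ 6 != 1 -> #[g] = 12.
Proof.
move=> /eqP; rewrite -!order_dvdn => d12.
have := dvdn_leq (isT : 0 < 12)%N d12; move: (order_gt0 g) d12.
by case: #[g] => [|[|[|[|[|[|[|[|[|[|[|[|[|]]]]]]]]]]]]].
Qed.

Lemma perm_neq1 (g : {perm 'I_n}) x (xn : (x < n)%N) :
  (g (Ordinal xn) : nat) != x -> g != 1.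
Proof. by apply: contraNneq => ->; rewrite perm1. Qed.

Lemma cycle3_expg3 (g : {perm 'I_n}) (a b u : nat) :
  a != b -> u != a -> u != b ->
  (forall x : 'I_n, g x = swap a u (swap a b x) :> nat) -> g ^+ 3 = 1.
Proof.
move=> ab ua ub gE; apply: perm_nat_eq => x.
rewrite !expgS expg0 mulg1 perm1 !permM !gE /swap.
by move: {x}(nat_of_ord x) (ltn_ord x) => x xn; ifs.
Qed.

Lemma order_rho12 : #[rho 1 * rho 2] = 12.
Proof.
apply: order_12.
- rewrite (expgM _ 4 3); apply: (cycle3_expg3 _ _ _ rho12_4); nat_lia.
- have x2 : (L + 2 < n)%N by nat_lia.
  by apply: (@perm_neq1 _ _ x2); rewrite rho12_4 /= /swap; ifs.
have x1 : (1 < n)%N by nat_lia.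
apply: (@perm_neq1 _ _ x1); rewrite (expgM _ 2 3).
by move: (_ ^+ 2) rho12_sqr => g gE; rewrite !expgS expg0 mulg1 !permM !gE /v12 /=; ifs.
Qed.

Lemma order_rho23 : #[rho 2 * rho 3] = 6.
Proof.
apply: order_6.
- rewrite (expgM _ 2 3); apply: (cycle3_expg3 _ _ _ rho23_2); nat_lia.
- have x2 : (L + 3 < n)%N by nat_lia.
  by apply: (@perm_neq1 _ _ x2); rewrite rho23_2 /= /swap; ifs.
have x1 : (2 < n)%N by nat_lia.
apply: (@perm_neq1 _ _ x1); rewrite !expgS expg0 mulg1 !permM !rhoE //=; try nat_lia.
by evl.
Qed.

Lemma order_braid a : (3 <= a)%N -> (a.+1 < r)%N -> a != r - 4 -> a != r - 3 ->
  #[rho a * rho a.+1] = 3.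
Proof.
move=> a3 ar a4 a5; apply: nt_prime_order => //; first exact: braid_expg3.
have xn : (L + 1 + a < n)%N by nat_lia.
by apply: (@perm_neq1 _ _ xn); rewrite !permM !rhoE //=; try nat_lia; ev.
Qed.

Lemma order_tau : #[rho (r - 4) * rho (r - 3)] = 6.
Proof.
apply: order_6.
- by rewrite (expgM _ 3 2) expg2 tauK.
- have xn : (L + r - 3 < n)%N by nat_lia.
  by apply: (@perm_neq1 _ _ xn); rewrite !expg2 !permM !rhoE //=; try nat_lia; ev.
have xn : (L + r < n)%N by nat_lia.
by apply: (@perm_neq1 _ _ xn); rewrite tauE /=; evt.
Qed.

Lemma order_flip4 : #[rho (r - 3) * rho (r - 2)] = 6.
Proof.
apply: order_6.
- by rewrite (expgM _ 3 2) expg2 flip4K.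
- have xn : (L + r - 2 < n)%N by nat_lia.
  by apply: (@perm_neq1 _ _ xn); rewrite !expg2 !permM !rhoE //=; try nat_lia; ev.
have xn : (L + r < n)%N by nat_lia.
by apply: (@perm_neq1 _ _ xn); rewrite flip4E /=; evt.
Qed.

Lemma zero_lt_n : (0 < n)%N. Proof. by nat_lia. Qed.

(** Starting from the end of the path, the product climbs over the even vertices and returns over
    the odd ones. *)
Lemma rho01_orbit m : (m <= L + 3)%N ->
  ((rho 0 * rho 1) ^+ m) (Ordinal zero_lt_n) =
    (if m.*2 <= L + 3 then m.*2 else 2 * L + 7 - m.*2)%N :> nat.
Proof.
elim: m => [|m IH] mL; first by rewrite expg0 perm1.
rewrite expgSr !permM !rhoE //; try nat_lia.
rewrite IH; last nat_lia.
by ifs; evl.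
Qed.

Lemma rho01_cycle : ((rho 0 * rho 1) ^+ (L + 4)) (Ordinal zero_lt_n) = Ordinal zero_lt_n.
Proof.
apply: val_inj; rewrite addnS expgSr !permM /= !rhoE //; try nat_lia.
by rewrite rho01_orbit //; ifs; evl.
Qed.

(* The powers of [rho 0 * rho 1] are transitive on the path labelled 0 and 1 and commute
   with each other. *)
Lemma rho01_semiregular m :
  ((rho 0 * rho 1) ^+ m) (Ordinal zero_lt_n) = Ordinal zero_lt_n -> (rho 0 * rho 1) ^+ m = 1.
Proof.
set w := rho 0 * rho 1 => w0; apply/permP=> x; rewrite perm1.
have [xL|xL] := leqP (L + 4) x.
  have wx : w x = x.
    by apply: val_inj; rewrite /w /= permM !rhoE //; try nat_lia; evl.
  by elim: (m) => [|k IH]; rewrite ?expg0 ?perm1 // expgSr permM IH.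
suff [k ->] : exists k, x = (w ^+ k) (Ordinal zero_lt_n).
  by rewrite -permM -expgD [(k + m)%N]addnC expgD permM w0.
exists (if odd x then (2 * L + 7 - x)./2 else x./2); apply: val_inj => /=.
by rewrite rho01_orbit; ifs.
Qed.

Lemma order_rho01 : #[rho 0 * rho 1] = (L + 4)%N.
Proof.
have d1 : #[rho 0 * rho 1] %| L + 4 by rewrite order_dvdn rho01_semiregular ?rho01_cycle.
apply/eqP; rewrite eqn_leq dvdn_leq //=; last nat_lia.
rewrite leqNgt; apply/negP=> lt_o.
have := rho01_orbit (m := #[rho 0 * rho 1]); rewrite expg_order perm1 /=.
have := order_gt0 (rho 0 * rho 1); move: lt_o; move: #[_] => k k1 k2 /(_ ltac:(nat_lia)).
by ifs.
Qed.

Lemma schlafli : schlafli_type r rho (type48 n r).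
Proof.
split=> [|i ir]; first by rewrite /type48 !size_cat size_nseq /=; nat_lia.
rewrite /type48.
case: i ir => [|[|[|i]]] ir; first by rewrite order_rho01 /=; nat_lia.
- exact: order_rho12.
- exact: order_rho23.
change (#[rho i.+3 * rho i.+4] = nth 0 (nseq (r - 7) 3 ++ [:: 6; 6; 3])%N i)%N.
rewrite nth_cat size_nseq nth_nseq; case: ifP => ir7.
  by rewrite order_braid ?ir7 //; nat_lia.
have [Ei|n4] := eqVneq i.+3 (r - 4)%N.
  have -> : i.+4 = (r - 3)%N by nat_lia.
  rewrite Ei order_tau.
  by have -> : (i - (r - 7))%N = 0%N by nat_lia.
have [Ei|n3] := eqVneq i.+3 (r - 3)%N.
  have -> : i.+4 = (r - 2)%N by nat_lia.
  rewrite Ei order_flip4.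
  by have -> : (i - (r - 7))%N = 1%N by nat_lia.
rewrite order_braid //.
by have -> : (i - (r - 7))%N = 2%N by nat_lia.
Qed.

(** * Intersections of intervals of generators *)

Lemma GG_fix i j (x : 'I_n) :
  (forall k, (i <= k < j)%N -> (k < r)%N -> vmap k x = x) ->
  forall g : {perm 'I_n}, g \in GG i j -> g x = x.
Proof.
move=> fx; apply: itv_gen_ind => [|g k kij kr gx]; first by rewrite perm1.
by rewrite permM gx; apply: val_inj; rewrite /= rhoE // fx.
Qed.

Lemma GG_stable i j (P : pred nat) :
  (forall k x, (i <= k < j)%N -> (k < r)%N -> (x < n)%N -> P x -> P (vmap k x)) ->
  forall g : {perm 'I_n}, g \in GG i j -> forall x : 'I_n, P x -> P (g x).
Proof.
move=> sP; apply: itv_gen_ind => [x|g k kij kr gP x Px]; first by rewrite perm1.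
by rewrite permM rhoE //; apply: sP => //; apply: gP.
Qed.

Lemma GG_stableE i j (P : pred nat) :
  (forall k x, (i <= k < j)%N -> (k < r)%N -> (x < n)%N -> P x -> P (vmap k x)) ->
  forall g : {perm 'I_n}, g \in GG i j -> forall x : 'I_n, P (g x) = P x.
Proof.
move=> sP g gG x; apply/idP/idP; last exact: GG_stable sP _ gG x.
have gVG : g^-1 \in GG i j by rewrite groupV.
by move/(GG_stable sP gVG); rewrite permK.
Qed.

Lemma GG_stable2 i j (P : nat -> nat -> bool) :
  (forall k x y, (i <= k < j)%N -> (k < r)%N -> (x < n)%N -> (y < n)%N ->
     P x y -> P (vmap k x) (vmap k y)) ->
  forall g : {perm 'I_n}, g \in GG i j -> forall x y : 'I_n, P x y -> P (g x) (g y).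
Proof.
move=> sP; apply: itv_gen_ind => [x y|g k kij kr gP x y Pxy]; first by rewrite !perm1.
by rewrite !permM !rhoE //; apply: sP => //; apply: gP.
Qed.

Lemma GG_low i j (x : 'I_n) (g : {perm 'I_n}) : (3 <= i)%N -> (x < L + 1 + i)%N ->
  g \in GG i j -> g x = x.
Proof.
move=> i3 xi; apply: GG_fix => k kij kr.
have [Ek|nk] := eqVneq k (r - 3)%N; last by ev.
by rewrite Ek; ev.
Qed.

(** * Stabilisers of points and blocks for the generators of index at least 3 *)

Lemma braidV b : (3 <= b)%N -> (b.+1 < r)%N -> b != r - 4 -> b != r - 3 ->
  (rho b.+1 * rho b) ^+ 3 = 1.
Proof.
move=> *; rewrite expg3V; [|by apply: rhoK; nat_lia|by apply: rhoK; nat_lia].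
by rewrite braid_expg3 ?invg1.
Qed.

Lemma tauV : (rho (r - 3) * rho (r - 4)) ^+ 3 = tau.
Proof.
rewrite expg3V; [|by apply: rhoK; nat_lia|by apply: rhoK; nat_lia].
by apply/eqP; rewrite -/tau eq_invg_mul tauK.
Qed.

Lemma flip4V : (rho (r - 2) * rho (r - 3)) ^+ 3 = flip4.
Proof.
rewrite expg3V; [|by apply: rhoK; nat_lia|by apply: rhoK; nat_lia].
by apply/eqP; rewrite -/flip4 eq_invg_mul flip4K.
Qed.

(** The Schreier argument with the generators read downwards from [rho j]. [Q] is only required to
    contain [GG k j], so that [tau] may be adjoined when a braid relation fails. *)
Lemma coset_right k j (Q : {group {perm 'I_n}}) (t := fun m => \prod_(a < m) rho (j - a)) :
  (3 <= k)%N -> (k <= j)%N -> (j < r)%N -> GG k j \subset Q ->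
  (forall a, (a < j - k)%N -> t a * (rho (j - a) * rho (j - a.+1)) ^+ 3 * (t a)^-1 \in Q) ->
  forall g, g \in GG k j.+1 -> exists2 m, (m <= (j - k).+1)%N & exists2 q, q \in Q & g = q * t m.
Proof.
move=> k3 kj jr /subsetP sQ br; apply: itv_gen_ind.
  by exists 0 => //; exists 1; rewrite /t ?big_ord0 ?mulg1.
move=> _ c kc cr [m ml [q qQ ->]].
have [//|||//|m' m'l [q' q'Q E]] := @schreier_step _ (fun a =>
  rho (j - a)) (j - k) Q _ _ _ br m (j - c) ml.
- by move=> a al; apply: rhoK; nat_lia.
- by move=> a b ab bl; apply: commute_sym; apply: rho_commute; nat_lia.
- by move=> a a0 al; apply: sQ; apply: mem_GG; nat_lia.
- nat_lia.
exists m' => //; exists (q * q'); first by rewrite groupM.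
by rewrite -!mulgA -E subKn //; nat_lia.
Qed.

Lemma coset_left i j (Q : {group {perm 'I_n}}) (t := fun m => \prod_(a < m) rho (i + a)) :
  (3 <= i)%N -> (i <= j)%N -> (j < r)%N -> GG i.+1 j.+1 \subset Q ->
  (forall a, (a < j - i)%N -> t a * (rho (i + a) * rho (i + a.+1)) ^+ 3 * (t a)^-1 \in Q) ->
  forall g, g \in GG i j.+1 -> exists2 m, (m <= (j - i).+1)%N & exists2 q, q \in Q & g = q * t m.
Proof.
move=> i3 ij jr /subsetP sQ br; apply: itv_gen_ind.
  by exists 0 => //; exists 1; rewrite /t ?big_ord0 ?mulg1.
move=> _ c kc cr [m ml [q qQ ->]].
have [//|||//|m' m'l [q' q'Q E]] := @schreier_step _ (fun a =>
  rho (i + a)) (j - i) Q _ _ _ br m (c - i) ml.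
- by move=> a al; apply: rhoK; nat_lia.
- by move=> a b ab bl; apply: rho_commute; nat_lia.
- by move=> a a0 al; apply: sQ; apply: mem_GG; nat_lia.
- nat_lia.
exists m' => //; exists (q * q'); first by rewrite groupM.
by rewrite -!mulgA -E subnKC //; nat_lia.
Qed.

(** The two values of [b] stand for y_(j+1) and z_(j+1); the image determines [m], that is, the
    coset. *)
Lemma coset_right_z j m (x : 'I_n) b : (j < r)%N -> (m <= j - 2)%N -> b \in [:: L + 2; L + r]%N ->
  x = (b + j)%N :> nat -> (\prod_(a < m) rho (j - a)) x = (b + j - m)%N :> nat.
Proof.
move=> jr mj bL xE; elim: m mj => [|m IH] mj; first by rewrite big_ord0 perm1 subn0.
rewrite big_ord_recr permM /= rhoE ?IH; try nat_lia.
by move: bL; rewrite !inE => /orP[] /eqP->; rewrite vmap_dn; nat_lia.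
Qed.

Lemma coset_left_y i m (x : 'I_n) : (3 <= i)%N -> (i + m <= r)%N -> 
  x = (L + 1 + i)%N :> nat -> (\prod_(a < m) rho (i + a)) x = (L + 1 + i + m)%N :> nat.
Proof.
move=> i3 mj xE; elim: m mj => [|m IH] mj; first by rewrite big_ord0 perm1 addn0.
rewrite big_ord_recr permM /= rhoE ?IH; try nat_lia.
by rewrite vmap_up; nat_lia.
Qed.

Lemma join_tau (H : {group {perm 'I_n}}) g : (forall h, h \in H -> commute tau h) ->
  g \in H <*> <[tau]> -> g \in H \/ g * tau \in H.
Proof.
move=> cH; rewrite cent_joinEr; last first.
  by rewrite cycle_subG; apply/centP=> h /cH.
have o2 : #[tau] = 2.
  apply: nt_prime_order => //; first by rewrite expg2 tauK.
  have xn : (L + r < n)%N by nat_lia.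
  by apply: (@perm_neq1 _ _ xn); rewrite tauE /=; evt.
case/mulsgP=> h t hH tH ->; have : t \in [set 1; tau] by rewrite -(cycle2g o2).
by case/set2P=> ->; [left | right]; rewrite ?mulg1 // -mulgA tauK mulg1.
Qed.

Lemma GG_gen_commute i j g : (forall k, (i <= k < j)%N -> (k < r)%N -> commute g (rho k)) ->
  forall h, h \in GG i j -> commute g h.
Proof.
move=> cg; apply: itv_gen_ind => [|h k kij kr ch]; first exact: commute1.
by apply: commuteM => //; apply: cg.
Qed.

Lemma conj_commute (gT : finGroupType) (t e : gT) : commute e t -> t * e * t^-1 = e.
Proof. by move=> C; rewrite -C mulgK. Qed.

Lemma prod_commute (gT : finGroupType) (e : gT) (f : nat -> gT) m :
  (forall a, (a < m)%N -> commute e (f a)) -> commute e (\prod_(a < m) f a).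
Proof.
elim: m => [|m IH] C; first by rewrite big_ord0; apply: commute1.
by rewrite big_ord_recr; apply: commuteM; [apply: IH => a am; apply: C; nat_lia | apply: C].
Qed.

Lemma tau_in i j : (i <= r - 4)%N -> (r - 3 < j)%N -> tau \in GG i j.
Proof. by move=> ir rj; apply: mem_GG_mul; apply: mem_GG; nat_lia. Qed.

Lemma flip4_in i j : (i <= r - 3)%N -> (r - 2 < j)%N -> flip4 \in GG i j.
Proof. by move=> ir rj; apply: mem_GG_mul; apply: mem_GG; nat_lia. Qed.

(** [Q] fixes y_i and the representative of length m carries it to y_(i+m), so m = 0. For j <= r - 3
    only one braid relation can fail; its cube [tau] commutes with the representative that
    conjugates it. *)
Lemma fix_left i j (Q : {group {perm 'I_n}}) g (x : 'I_n) :
  (3 <= i)%N -> (i <= j)%N -> (j <= r - 3)%N -> GG i.+1 j.+1 \subset Q ->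
  (forall q, q \in Q -> q x = x) ->
  ((i <= r - 4)%N -> j = (r - 3)%N -> tau \in Q) -> x = (L + 1 + i)%N :> nat ->
  g \in GG i j.+1 -> g x = x -> g \in Q.
Proof.
move=> i3 ij jr sQ fQ tQ xE gG gx.
have jr' : (j < r)%N by nat_lia.
have [|m ml [q qQ Eg]] := coset_left i3 ij jr' sQ _ gG.
  move=> a al; rewrite addnS.
  have [E4|n4] := eqVneq (i + a)%N (r - 4)%N.
    rewrite E4 (_ : (r - 4).+1 = r - 3)%N; last nat_lia.
    rewrite -/tau conj_commute; first by apply: tQ; nat_lia.
    by apply: (@prod_commute _ tau (fun b => rho (i + b))) => b ba; apply: tau_commute; nat_lia.
  by rewrite braid_expg3 ?mulg1 ?mulgV //; nat_lia.
suff m0 : m = 0 by rewrite Eg m0 big_ord0 mulg1.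
have := coset_left_y (i := i) (m := m) i3 _ xE.
have -> : (\prod_(a < m) rho (i + a)) x = g x by rewrite Eg permM (fQ q qQ).
by rewrite gx xE; nat_lia.
Qed.

Lemma fix_right k j (Q : {group {perm 'I_n}}) g (x : 'I_n) :
  (3 <= k)%N -> (k <= j)%N -> (j <= r - 3)%N -> GG k j \subset Q ->
  (forall q, q \in Q -> q x = x) ->
  ((k < j)%N -> j = (r - 3)%N -> tau \in Q) -> x = (L + r + j)%N :> nat ->
  g \in GG k j.+1 -> g x = x -> g \in Q.
Proof.
move=> k3 kj jr sQ fQ tQ xE gG gx.
have jr' : (j < r)%N by nat_lia.
have [|m ml [q qQ Eg]] := coset_right k3 kj jr' sQ _ gG.
  move=> a al; rewrite (_ : j - a = (j - a.+1).+1)%N; last nat_lia.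
  have [E4|n4] := eqVneq (j - a.+1)%N (r - 4)%N.
    have [Ea Ej] : a = 0%N /\ j = (r - 3)%N by nat_lia.
    rewrite E4 (_ : (r - 4).+1 = r - 3)%N; last nat_lia.
    by rewrite tauV Ea big_ord0 mul1g invg1 mulg1; apply: tQ; nat_lia.
  by rewrite braidV ?mulg1 ?mulgV //; nat_lia.
suff m0 : m = 0 by rewrite Eg m0 big_ord0 mulg1.
have := @coset_right_z j m x (L + r) _ _ _ xE.
have -> : (\prod_(a < m) rho (j - a)) x = g x by rewrite Eg permM (fQ q qQ).
by rewrite gx xE !inE eqxx orbT; nat_lia.
Qed.

(* The pair {y_r, z_r}, a block for [rho 3], ..., [rho (r - 1)]. *)
Definition blockP := [pred x : nat | (x == L + r + 1)%N || (x == L + 2 * r - 1)%N].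

(** A block replaces the point because [rho (r - 3)] exchanges y_r and z_r. Both exceptional cubes
    can occur here: [flip4] commutes with the representative [rho (r - 1)], and [tau_conj] brings
    the conjugate of [tau] back into [GG k (r - 1)]. *)
Lemma block_right k g (x : 'I_n) : (3 <= k)%N -> (k <= r - 1)%N -> x = (L + 2 * r - 1)%N :> nat ->
  g \in GG k r -> blockP (g x) -> g \in GG k (r - 1).
Proof.
move=> k3 kr xE gG gx; rewrite (_ : GG k r = GG k (r - 1).+1) in gG; last by congr (GG _ _);
  nat_lia.
have jr' : (r - 1 < r)%N by nat_lia.
have [|m ml [q qQ Eg]] := coset_right k3 kr jr' (subxx _) _ gG.
  move=> a al; rewrite (_ : r - 1 - a = (r - 1 - a.+1).+1)%N; last nat_lia.
  have [E4|n4] := eqVneq (r - 1 - a.+1)%N (r - 4)%N.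
    have Ea : a = 2 by nat_lia.
    rewrite E4 (_ : (r - 4).+1 = r - 3)%N; last nat_lia.
    rewrite tauV Ea !big_ord_recl big_ord0 /= mulg1 subn0 -subnDA invMg.
    rewrite !(sggi_inv rho_sggi); try nat_lia.
    rewrite tau_conj groupM ?groupM //; try (by apply: mem_GG; nat_lia); by apply: tau_in; nat_lia.
  have [E3|n3] := eqVneq (r - 1 - a.+1)%N (r - 3)%N.
    have Ea : a = 1%N by nat_lia.
    rewrite E3 (_ : (r - 3).+1 = r - 2)%N; last nat_lia.
    rewrite flip4V Ea big_ord_recl big_ord0 /= mulg1 subn0 conj_commute; first
      by apply: flip4_in; nat_lia.
    exact/commute_sym/flip4_commute.
  by rewrite braidV ?mulg1 ?mulgV ?group1 //; nat_lia.
have [|m0] := posnP m; first by move=> m0; rewrite Eg m0 big_ord0 mulg1.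
have sq : blockP (q x).
  apply: (GG_stable _ qQ); last by rewrite /= xE eqxx orbT.
  move=> c y kc cr yn /orP[] /eqP->.
    have [->|nc] := eqVneq c (r - 3)%N; first by rewrite /=; ev.
    by rewrite /=; ev.
  have [->|nc] := eqVneq c (r - 3)%N; first by rewrite /=; ev.
  by rewrite /=; ev.
have : blockP ((\prod_(a < m) rho (r - 1 - a)) (q x)) by rewrite -permM -Eg.
case/orP: sq => /eqP qx.
  by rewrite /= (@coset_right_z (r - 1) m (q x) (L + 2)); rewrite ?inE ?eqxx ?qx //; nat_lia.
by rewrite /= (@coset_right_z (r - 1) m (q x) (L + r)); rewrite ?inE ?eqxx ?orbT ?qx //; nat_lia.
Qed.

Lemma GG_dihedral i g : (i.+1 < r)%N -> g \in GG i i.+2 ->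
  exists2 c, c \in <[rho i * rho i.+1]> & g = c \/ g = rho i.+1 * c.
Proof.
set a := rho i; set b := rho i.+1 => ir.
have aK : a * a = 1 by apply: rhoK; nat_lia.
have bK : b * b = 1 by apply: rhoK.
have cb c : c \in <[a * b]> -> c * b = b * c^-1.
  case/cycleP=> m ->; have bV : b^-1 = b by apply/eqP; rewrite eq_invg_mul bK.
  have aV : a^-1 = a by apply/eqP; rewrite eq_invg_mul aK.
  have E : (a * b) ^ b = (a * b)^-1 by rewrite /conjg invMg bV aV -!mulgA bK mulg1.
  by rewrite -expgVn -E -conjXg /conjg !mulgA mulgV mul1g.
have ca c : c \in <[a * b]> -> c * a = b * (c * (a * b))^-1.
  by move=> cG; rewrite -(cb _ (groupM cG (cycle_id _))) -!mulgA bK mulg1.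
move: g; apply: itv_gen_ind; first by exists 1; rewrite ?group1 //; left.
move=> g k kij kr [c cG E]; have [->|->] : k = i \/ k = i.+1 by nat_lia.
  exists (c * (a * b))^-1; first by rewrite groupV groupM ?cycle_id.
  case: E => ->; [right; exact: ca | left].
  by rewrite -/a -mulgA ca // mulgA bK mul1g.
exists c^-1; first by rewrite groupV.
case: E => ->; [right; exact: cb | left].
by rewrite -/b -mulgA cb // mulgA bK mul1g.
Qed.

(** [tau] and [rho (r - 2)] both fix y_(r-3), while [rho (r - 3) * rho (r - 2)] has order 6 and a
    6-cycle through it. So the rotation part would be trivial, and [tau] would be 1 or
    [rho (r - 2)]. *)
Lemma tau_notin : tau \notin GG (r - 3) (r - 1).
Proof.
apply/negP; rewrite (_ : GG (r - 3) (r - 1) = GG (r - 3) (r - 3).+2); last by congr (GG _ _);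
  nat_lia.
move=> tG; have [|c cG E] := GG_dihedral _ tG; first nat_lia.
have E2 : (r - 3).+1 = (r - 2)%N by nat_lia.
rewrite {}E2 in cG E; have xn : (L + r - 2 < n)%N by nat_lia.
have cx : c (Ordinal xn) = Ordinal xn.
  have : tau (Ordinal xn) = Ordinal xn by apply: val_inj; rewrite /= tauE /=; evt.
  case: E => -> //; rewrite permM => E3; rewrite -[RHS]E3; congr (c _); apply/esym/val_inj.
  by rewrite /= rhoE /=; [ev | nat_lia].
have c1 : c = 1.
  have w6 : (rho (r - 3) * rho (r - 2)) ^+ 6 = 1 by rewrite -order_flip4 expg_order.
  case/cycleP: cG cx => m ->;
    rewrite (divn_eq m 6) expgD [(m %/ 6 * 6)%N]mulnC expgM w6 expg1n mul1g.
  have : (m %% 6 < 6)%N by rewrite ltn_mod.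
  move: (m %% 6)%N => s s6 /(congr1 val) /= sx.
  have [->|ne0] := eqVneq s 0%N; first by rewrite expg0.
  exfalso; move: sx.
  have [->|[->|[->|[->|->]]]] : s = 1%N \/ s = 2 \/ s = 3 \/ s = 4 \/ s = 5 by nat_lia.
  - by rewrite expg1 !permM !rhoE //=; try nat_lia; ev.
  - by rewrite !expgS expg0 mulg1 !permM !rhoE //=; try nat_lia; ev.
  - by rewrite !expgS expg0 mulg1 !permM !rhoE //=; try nat_lia; ev.
  - by rewrite !expgS expg0 mulg1 !permM !rhoE //=; try nat_lia; ev.
  by rewrite !expgS expg0 mulg1 !permM !rhoE //=; try nat_lia; ev.
have yn : (L + r - 1 < n)%N by nat_lia.
have zn : (L + r < n)%N by nat_lia.
case: E; rewrite c1 ?mulg1 => E.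
  by have := tauE (Ordinal zn); rewrite E perm1 /=; evt.
by have := tauE (Ordinal yn); rewrite E rhoE /=; [evt | nat_lia].
Qed.

Lemma step_high i j g : (3 <= i)%N -> (i < j)%N -> (j <= r - 2)%N ->
  g \in GG i j -> g \in GG i.+1 j.+1 -> g \in GG i.+1 j.
Proof.
move=> i3 ij jr gG gG'.
have xn : (L + 1 + i < n)%N by nat_lia.
pose x := Ordinal xn.
have fx q a b : (i < a)%N -> q \in GG a b -> q x = x.
  by move=> ia; apply: GG_low; rewrite /=; nat_lia.
have gx : g x = x by apply: (fx _ _ _ (leqnn _) gG').
have Ej : j = (j - 1).+1 by nat_lia.
have sGj : GG i.+1 (j - 1).+1 \subset GG i.+1 j by rewrite -Ej.
rewrite Ej in gG.
(* Exceptional case: [GG i.+1 j] is generated by [rho (r - 3)] alone and does not contain [tau],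
   which is adjoined and then ruled out by [tau_notin]. *)
have [Es|Es] := boolP ((i == r - 4) && (j == r - 2))%N; last first.
  apply: (fix_left i3 _ _ sGj _ _ (erefl : x = (L + 1 + i)%N :> nat) gG gx); try nat_lia.
    by move=> q; apply: fx.
  by move=> i4 j3; apply: tau_in; nat_lia.
have [/eqP Ei /eqP Ej2] := andP Es.
have ct h : h \in GG i.+1 j -> commute tau h.
  apply: GG_gen_commute => k kij kr; have -> : k = (r - 3)%N by nat_lia.
  exact: tau_commute_rev.
have tx : tau x = x by apply: val_inj; rewrite /= tauE vtau_id //= Ei; nat_lia.
have : g \in GG i.+1 j <*> <[tau]>.
  apply: (fix_left i3 _ _ _ _ _ (erefl : x = (L + 1 + i)%N :> nat) gG gx); try nat_lia.
  - by apply: subset_trans sGj _; apply: joing_subl.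
  - move=> q /(join_tau ct)[|qt]; first exact: fx.
    have := fx _ _ _ (leqnn _) qt; rewrite permM => E; apply: (@perm_inj _ tau).
    by rewrite E tx.
  by move=> _ _; apply: (subsetP (joing_subr _ _)); apply: cycle_id.
case/(join_tau ct) => // gt; case/negP: tau_notin.
have -> : tau = g^-1 * (g * tau) by rewrite mulKg.
rewrite groupM //.
  by rewrite groupV; apply: subsetP gG'; apply: GG_S; nat_lia.
by apply: subsetP gt; apply: GG_S; nat_lia.
Qed.

Lemma step_last i g : (2 <= i)%N -> (i < r - 1)%N ->
  g \in GG i (r - 1) -> g \in GG i.+1 r -> g \in GG i.+1 (r - 1).
Proof.
move=> i2 ir gG gG'; have xn : (L + 2 * r - 1 < n)%N by nat_lia.
apply: (@block_right i.+1 g (Ordinal xn)) => //.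
apply: (GG_stable _ gG); last by rewrite /= eqxx orbT.
move=> c y kc cr yn /orP[] /eqP->.
  have [->|nc] := eqVneq c (r - 3)%N; first by rewrite /=; ev.
  by have [c2|c2] := ltnP c 3; [rewrite vmap_low /=; nat_lia | rewrite /=; ev].
have [->|nc] := eqVneq c (r - 3)%N; first by rewrite /=; ev.
by have [c2|c2] := ltnP c 3; [rewrite vmap_low /=; nat_lia | rewrite /=; ev].
Qed.

(** * The orbit of y_2 and the steps for i = 2 and i = 1 *)

(* The orbit of y_2 under [rho 1], ..., [rho m]. *)
Definition Xp m := [pred x : nat | [&& (L + 2 <= x), (m < r - 2) ==> (x < L + 3 + m) &
  (m == r - 2) ==> (x < L + r + 1) || (L + r + 2 <= x < L + 2 * r - 1)]%N].

Lemma Xp_vmap m k x : (1 <= k)%N -> (k <= m)%N -> (2 <= m)%N -> (m < r)%N -> (x < n)%N ->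
  Xp m x -> Xp m (vmap k x).
Proof.
move=> k1 km m2 mr xn Xx.
have [k3|k3] := ltnP k 3.
  have [xl|xl] := ltnP (L + 4) x; first by rewrite vmap_low //; nat_lia.
  have : (x = L + 2 \/ x = L + 3 \/ x = L + 4)%N by move: Xx => /=; nat_lia.
  have [->|->] : k = 1%N \/ k = 2%N by nat_lia.
    by regions x; evl; move: Xx => /=; nat_lia.
  by regions x; evl; move: Xx => /=; nat_lia.
have [Ek|nk] := eqVneq k (r - 3)%N.
  rewrite Ek.
  have : (x < L + r - 2 \/ x = L + r - 2 \/ x = L + r - 1 \/ x = L + r \/ x = L + r + 1 \/
    L + r + 2 <= x < L + 2 * r - 4 \/ x = L + 2 * r - 4 \/ x = L + 2 * r - 3 \/
    x = L + 2 * r - 2 \/ x = L + 2 * r - 1)%N by nat_lia.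
  by regions x; ev; move: Xx => /=; nat_lia.
have : ((x < L + 1 + k)%N || (L + 3 + k <= x < L + r + k - 1)%N || (L + r + k + 1 <= x)%N \/
  x = L + 1 + k \/ x = L + 2 + k \/ x = L + r + k - 1 \/ x = L + r + k)%N by nat_lia.
by regions x; ev; move: Xx => /=; nat_lia.
Qed.

Lemma Xp_GG m i j g (x : 'I_n) : (1 <= i)%N -> (2 <= m)%N -> (m < r)%N -> (j <= m.+1)%N ->
  g \in GG i j -> (g x \in vset (Xp m)) = (x \in vset (Xp m)).
Proof.
move=> i1 m2 mr jm gG; rewrite !inE; apply: (GG_stableE (i := i) (j := j) (P := Xp m) _ gG).
move=> k y kij kr yn Xy; by apply: Xp_vmap => //; nat_lia.
Qed.

Lemma perm_on_conj (T : finType) (X : {set T}) (a h : {perm T}) :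
  (forall x, (h x \in X) = (x \in X)) -> perm_on X a -> perm_on X (h * a * h^-1).
Proof.
move=> hX aX; apply/subsetP=> x; rewrite inE; apply: contraR => xX.
by rewrite !permM (out_perm aX) ?hX // permK.
Qed.

Lemma GG_even i j g : g \in GG i j -> ~~ odd_perm g.
Proof.
move: g; apply: itv_gen_ind => [|g k kij kr ge]; first by rewrite odd_perm1.
by rewrite odd_permM (negbTE ge) (negbTE (rho_even kr)).
Qed.

(* Modulo the alternating group on [Xp m], [rho 1] and [rho 2] commute with the later generators. *)
Lemma decompose i m g : (1 <= i <= 2)%N -> (2 <= m)%N -> (m < r)%N -> g \in GG i m.+1 ->
  exists a, exists w, exists s, [/\ perm_on (vset (Xp m)) a, ~~ odd_perm a,
    w \in GG i 3, s \in GG 3 m.+1 & g = a * w * s].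
Proof.
move=> i12 m2 mr; move: g; apply: itv_gen_ind.
  by exists 1, 1, 1; rewrite !group1 perm_on1 odd_perm1 !mulg1.
move=> _ k kim kr [a [w [s [aX ae wG sG ->]]]].
have [k3|k3] := leqP 3 k.
  exists a, w, (s * rho k); rewrite !mulgA; split=> //.
  by rewrite groupM // mem_GG //; nat_lia.
have w'G : w * rho k \in GG i 3 by rewrite groupM // mem_GG //; nat_lia.
have [Ek|nk] := eqVneq k 1%N.
  exists a, (w * rho k), s; split=> //; rewrite -!mulgA; congr (_ * (_ * _)); symmetry.
  apply: (GG_gen_commute _ sG) => l lm lr; rewrite Ek.
  by apply: rho_commute; nat_lia.
have {nk} Ek : k = 2 by nat_lia.
(* This commutator is what [rho 2] leaves behind when moved in front of [s]. It is even; outside the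
   orbit it is trivial, because there [s] acts trivially below L + 4 and [rho 2] acts trivially from
   L + 5 on. *)
pose d := rho k * s * (rho k) * s^-1.
have sX x : (s x \in vset (Xp m)) = (x \in vset (Xp m)) by apply: (Xp_GG _ _ _ _ _ sG).
have sl (x : 'I_n) : (x < L + 4)%N -> s x = x.
  by move=> xl; apply: (GG_low _ _ sG); nat_lia.
have dX : perm_on (vset (Xp m)) d.
  apply/subsetP=> x; rewrite inE; apply: contraR => xX; rewrite /d !permM.
  apply/eqP; apply: (@perm_inj _ s); rewrite permKV.
  have [xl|xl] := ltnP x (L + 4).
    have x2 : rho k x < L + 4.
      rewrite rhoE // Ek; move: xX; rewrite inE /=.
      have [->|x2] := eqVneq (nat_of_ord x) 2; first by rewrite vmap2_up; nat_lia.
      have [->|x3] := eqVneq (nat_of_ord x) 3; first by rewrite vmap2_dn; nat_lia.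
      by move=> ?; rewrite vmap2_id; nat_lia.
    by rewrite (sl _ x2) (sl _ xl) -permM rhoK // perm1.
  have xl5 : (L + 5 <= x)%N by move: xX; rewrite inE /=; nat_lia.
  have fk (y : 'I_n) : (L + 5 <= y)%N -> rho k y = y.
    by move=> yl; apply: val_inj; rewrite /= rhoE // Ek vmap2_id; nat_lia.
  rewrite (fk x) //; apply: fk.
  have := sX x; rewrite (negbTE xX) => /negbT sxX.
  have [sxl|sxl] := ltnP (s x) (L + 4).
    by have := sl _ sxl; move/perm_inj => E; rewrite E in sxl; nat_lia.
  by move: sxX; rewrite inE /=; nat_lia.
exists (a * ((w * rho k) * d * (w * rho k)^-1)), (w * rho k), s; split=> //.
- rewrite perm_onM // perm_on_conj // => x.
  by apply: (Xp_GG _ _ _ _ _ w'G); nat_lia.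
- rewrite /d !odd_permM !odd_permV !odd_permM (negbTE ae).
  by case: (odd_perm w); case: (odd_perm (rho k)); case: (odd_perm s).
have [W EW] : exists W, W = w * rho k by exists (w * rho k).
rewrite -EW mulgA mulgKV /d EW -!mulgA mulVg mulg1 (mulgA (rho k) (rho k) (s * _)).
by rewrite rhoK // mul1g.
Qed.

Lemma alt_Xp1 m : (2 <= m)%N -> (m <= r - 2)%N -> alt_in (vset (Xp m)) (GG 1 m.+1).
Proof.
move=> m2 mr; have [->|n2] := eqVneq m 2.
  by apply: alt_inS alt_base1; rewrite ?subxx //= => y; nat_lia.
have [Em|nr] := eqVneq m (r - 2)%N.
  have A := grow_z (lo := L + 2) _ (i := 1) _ alt_base13 (leqnn (r - 4)).
  rewrite Em (_ : (r - 2).+1 = r - 1)%N; last nat_lia.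
  by apply: alt_inS (A _ _); rewrite ?subxx //=; try nat_lia; move=> y; nat_lia.
have A := grow_y (lo := L + 2) _ (i := 1) _ alt_base13 (m := m).
by apply: alt_inS (A _ _ _); rewrite ?subxx //=; try nat_lia; move=> y; nat_lia.
Qed.

Lemma alt_Xp2 m : (2 <= m)%N -> (m <= r - 2)%N ->
  alt_in (vset [pred x | (L + 3 <= x)%N && Xp m x]) (GG 2 m.+1).
Proof.
move=> m2 mr; have [->|n2] := eqVneq m 2.
  by apply: (alt_in_pair (u := L + 3)); [nat_lia | move=> y /=; nat_lia].
have [Em|nr] := eqVneq m (r - 2)%N.
  have A := grow_z (lo := L + 3) _ (i := 2) _ alt_base2 (leqnn (r - 4)).
  rewrite Em (_ : (r - 2).+1 = r - 1)%N; last nat_lia.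
  by apply: alt_inS (A _ _); rewrite ?subxx //=; try nat_lia; move=> y; nat_lia.
have A := grow_y (lo := L + 3) _ (i := 2) _ alt_base2 (m := m).
by apply: alt_inS (A _ _ _); rewrite ?subxx //=; try nat_lia; move=> y; nat_lia.
Qed.

Lemma GG_fix_low i j g (x : 'I_n) : (2 <= i)%N -> (x < 2)%N || (4 <= x < L + 3)%N ->
  g \in GG i j -> g x = x.
Proof.
move=> i2 xl; apply: GG_fix => k kij kr.
have [Ek|nk] := eqVneq k (r - 3)%N; first by rewrite Ek; ev.
have [k3|k3] := ltnP k 3; last by ev.
by rewrite (_ : k = 2) ?vmap2_id //; nat_lia.
Qed.

Lemma GG_fix0 j g (x : 'I_n) : x = 0 :> nat -> g \in GG 1 j -> g x = x.
Proof.
move=> x0; apply: GG_fix => k kij kr; rewrite x0.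
have [Ek|nk] := eqVneq k (r - 3)%N; first by rewrite Ek; ev.
have [k3|k3] := ltnP k 3; last by ev.
by have [->|->] : k = 1%N \/ k = 2 by nat_lia; evl.
Qed.

Lemma GG_fix_high i g (x : 'I_n) : (L + 5 <= x)%N -> g \in GG i 3 -> g x = x.
Proof. by move=> xl; apply: GG_fix => k kij kr; apply: vmap_low; nat_lia. Qed.

Lemma perm_on_vset (P : pred nat) (g : {perm 'I_n}) :
  (forall x : 'I_n, ~~ P x -> g x = x) -> perm_on (vset P) g.
Proof.
move=> fg; apply/subsetP=> x; rewrite !inE; apply: contraR => /fg ->; exact: eqxx.
Qed.

Lemma out_vset (P : pred nat) (g : {perm 'I_n}) (x : 'I_n) :
  perm_on (vset P) g -> ~~ P x -> g x = x.
Proof. by move=> gP Px; apply: (out_perm gP); rewrite inE. Qed.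

Lemma GG_single i g : (i < r)%N -> g \in GG i i.+1 -> g = 1 \/ g = rho i.
Proof.
move=> ir; move: g; apply: itv_gen_ind; first by left.
move=> g k kij kr E; have -> : k = i by nat_lia.
by case: E => ->; [right; rewrite mul1g | left; rewrite rhoK].
Qed.

(** Says that [u] and [v] form a block {y_k, z_k} with k >= 3, in either order. *)
Definition pairP (u v : nat) := (L + 4 <= u)%N && (v == u + (r - 2))%N ||
  (L + 4 <= v)%N && (u == v + (r - 2))%N.

Lemma pairP_GG j g (x y : 'I_n) : g \in GG 3 j -> pairP x y -> pairP (g x) (g y).
Proof.
move=> gG; apply: (GG_stable2 _ gG) => k {}x {}y kij kr xn yn.
wlog : x y xn yn / (L + 4 <= x)%N && (y == x + (r - 2))%N.
  move=> W; case/orP => P; first by apply: W; rewrite // /pairP P.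
  by rewrite /pairP orbC; apply: (W y x); rewrite // /pairP P.
case/andP=> xl /eqP Ey _; rewrite {y}Ey in yn *.
have [Ek|nk] := eqVneq k (r - 3)%N.
  have : (x < L + r - 2 \/ x = L + r - 2 \/ x = L + r - 1 \/ x = L + r \/ x = L + r + 1)%N
    by nat_lia.
  by rewrite Ek; regions x; ev; rewrite /pairP; nat_lia.
have : ((x < L + 1 + k)%N || (L + 3 + k <= x)%N \/
  x = L + 1 + k \/ x = L + 2 + k)%N by nat_lia.
by regions x; ev; rewrite /pairP; nat_lia.
Qed.

(** Writing [g = a * w * s], the product [a * w] lies in [GG 3 j.+1]. It fixes p_3, which excludes
    [w = rho 2]. Then [a] preserves the pairing of y_k with z_k but fixes every z_k, so it fixes
    every y_k too and is trivial. *)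
Lemma step_2 j g : (3 <= j)%N -> (j <= r - 2)%N ->
  g \in GG 2 j -> g \in GG 3 j.+1 -> g \in GG 3 j.
Proof.
move=> j3 jr gG gG'; have Ej : j = (j - 1).+1 by nat_lia.
rewrite {1}Ej in gG; have jr1 : (j - 1 < r)%N by nat_lia.
have [//||//|a [w [s [aX ae wG sG Eg]]]] := decompose _ _ _ gG; first nat_lia.
rewrite -Ej in sG.
suff aw1 : a * w = 1 by rewrite Eg aw1 mul1g.
have bG : a * w \in GG 3 j.+1.
  rewrite (_ : a * w = g * s^-1); last by rewrite Eg mulgK.
  by rewrite groupM ?groupV //; apply: subsetP sG; apply: GG_S.
have bl (x : 'I_n) : (x < L + 4)%N -> (a * w) x = x.
  by move=> xl; apply: (GG_low _ _ bG); nat_lia.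
have w1 : w = 1.
  have [|//|Ew] := GG_single _ wG; first nat_lia.
  have x2 : (2 < n)%N by nat_lia.
  have := bl (Ordinal x2); rewrite permM (out_vset aX) /=; last nat_lia.
  by move=> /(_ ltac:(nat_lia))/(congr1 val); rewrite /= Ew rhoE /=; [evl | nat_lia].
rewrite {}w1 mulg1 in bG bl *; apply/permP=> x; rewrite perm1.
have [xX|] := boolP (Xp (j - 1) x); last exact: out_vset aX.
have [xl|xl] := ltnP x (L + 4); first exact: bl.
have yn : (x + (r - 2) < n)%N by move: xX => /=; nat_lia.
have : pairP (a x) (a (Ordinal yn)) by apply: pairP_GG bG _; rewrite /pairP /=; nat_lia.
rewrite (out_vset aX (x := Ordinal yn)) /=; last by move: xX => /=; nat_lia.
by rewrite /pairP => P; apply: val_inj; move: (ltn_ord (a x)) => /=; nat_lia.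
Qed.

(** Vertex 1 lies on the 4-cycle of [rho 1 * rho 2] and is fixed by [rho 2]. A rotation fixing it is
    a power of the fourth power, hence of the 3-cycle on [Xp 2]. *)
Lemma rho12_stab w (x : 'I_n) : x = 1%N :> nat -> w \in GG 1 3 -> w x = x ->
  exists e, exists c, [/\ e \in GG 2 3, perm_on (vset (Xp 2)) c, ~~ odd_perm c & w = e * c].
Proof.
move=> x1 wG wx; have [|c cG E] := GG_dihedral _ wG; first nat_lia.
have r2x : rho 2 x = x by apply: val_inj; rewrite /= rhoE ?x1; [evl | nat_lia].
have cx : c x = x.
  by case: E wx => -> //; rewrite permM r2x.
have ce : ~~ odd_perm c.
  apply: (@GG_even 1 3); apply: subsetP cG; rewrite cycle_subG.
  by rewrite groupM // mem_GG //; nat_lia.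
have cX : perm_on (vset (Xp 2)) c.
  case/cycleP: cG cx => m ->; rewrite (divn_eq m 4) expgD [(m %/ 4 * 4)%N]mulnC expgM.
  set v := rho 1 * rho 2.
  have v4 : perm_on (vset (Xp 2)) ((v ^+ 4) ^+ (m %/ 4)).
    elim: (m %/ 4)%N => [|d IH]; first by rewrite expg0 perm_on1.
    rewrite expgS perm_onM //; apply: perm_on_vset => y yX; apply: val_inj.
    by rewrite /= rho12_4 /swap; move: yX => /=; ifs.
  rewrite permM (out_vset v4); last by rewrite /= x1; nat_lia.
  have : (m %% 4 < 4)%N by rewrite ltn_mod.
  move: (m %% 4)%N => s s4 /(congr1 val) /= sx.
  have [->|ne0] := eqVneq s 0%N; first by rewrite expg0 mulg1.
  exfalso; move: sx; rewrite x1 /v.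
  have [->|[->|->]] : s = 1%N \/ s = 2 \/ s = 3 by nat_lia.
  - by rewrite expg1 !permM !rhoE; try nat_lia; rewrite x1; evl.
  - by rewrite !expgS expg0 mulg1 !permM !rhoE; try nat_lia; rewrite x1; evl.
  by rewrite !expgS expg0 mulg1 !permM !rhoE; try nat_lia; rewrite x1; evl.
case: E => ->; first by exists 1, c; rewrite group1 mul1g.
by exists (rho 2), c; split=> //; apply: mem_GG; nat_lia.
Qed.

(** Being in [GG 2 j.+1], [g] fixes p_2 and q_(L-1). The first fact reduces [w] to a power of
    [rho 2] times an even factor that [a] absorbs; the second removes q_(L-1) from the support of
    the new [a], so that [alt_Xp2] applies. *)
Lemma step_1 j g : (2 <= j)%N -> (j < r)%N ->
  g \in GG 1 j -> g \in GG 2 j.+1 -> g \in GG 2 j.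
Proof.
move=> j2 jr gG gG'.
have x1n : (1 < n)%N by nat_lia.
have x2n : (L + 2 < n)%N by nat_lia.
have g1 : g (Ordinal x1n) = Ordinal x1n by apply: (GG_fix_low _ _ gG').
have g2 : g (Ordinal x2n) = Ordinal x2n by apply: (GG_fix_low _ _ gG') => //=; nat_lia.
have [E2|n2] := eqVneq j 2.
  rewrite E2 in gG *; have [|->|Eg] := GG_single _ gG; [nat_lia | exact: group1 | ].
  move/(congr1 val): g1; rewrite /= Eg rhoE //=; last nat_lia.
  by evl.
have Ej : j = (j - 1).+1 by nat_lia.
rewrite {1}Ej in gG; have jr1 : (j - 1 < r)%N by nat_lia.
have [//||//|a [w [s [aX ae wG sG Eg]]]] := decompose _ _ _ gG; first nat_lia.
rewrite -Ej in sG.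
have s1 : s (Ordinal x1n) = Ordinal x1n by apply: (GG_low _ _ sG) => //=; nat_lia.
have a1 : a (Ordinal x1n) = Ordinal x1n by apply: (out_vset aX); rewrite /=; nat_lia.
have w1 : w (Ordinal x1n) = Ordinal x1n.
  by apply: (@perm_inj _ s); rewrite s1 -[RHS]g1 Eg !permM a1.
have [//|e [c [eG cX ce Ew]]] := rho12_stab _ wG w1.
have eG1 : e \in GG 1 3 by apply: subsetP eG; apply: GG_S.
pose a' := a * (e * c * e^-1).
have esG : e * s \in GG 2 j.
  rewrite groupM //; first by apply: subsetP eG; apply: GG_S; nat_lia.
  by apply: subsetP sG; apply: GG_S.
have Eg' : g = a' * (e * s) by rewrite Eg Ew /a' !mulgA mulgKV.
have a'X : perm_on (vset (Xp (j - 1))) a'.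
  rewrite perm_onM // perm_on_conj // => [x|]; first by apply: (Xp_GG _ _ _ _ _ eG1); nat_lia.
  by apply: perm_onS cX; apply/subsetP=> x; rewrite !inE /=; nat_lia.
have a'2 : a' (Ordinal x2n) = Ordinal x2n.
  apply: (@perm_inj _ (e * s)); rewrite -permM -Eg' g2.
  by apply/esym/(GG_fix_low _ _ esG) => //=; nat_lia.
rewrite Eg' groupM // [in GG _ _]Ej; apply: alt_Xp2; try nat_lia.
  apply: perm_on_vset => x; have [Ex|nx] := eqVneq (nat_of_ord x) (L + 2).
    by move=> _; rewrite (_ : x = Ordinal x2n) //; apply: val_inj.
  by move=> xX; apply: (out_vset a'X); move: xX nx => /=; nat_lia.
by rewrite /a' !odd_permM odd_permV (negbTE ae) (negbTE ce); case: (odd_perm e).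
Qed.

(** * The steps for i = 0 *)

Lemma rho01_step g : g \in GG 0 2 -> g \in GG 1 3 -> g \in GG 1 2.
Proof.
move=> gG gG'; have gx : g (Ordinal zero_lt_n) = Ordinal zero_lt_n by apply: (GG_fix0 _ gG').
have [|c cG E] := GG_dihedral _ gG; first nat_lia.
have r1x : rho 1 (Ordinal zero_lt_n) = Ordinal zero_lt_n.
  by apply: val_inj; rewrite /= rhoE /=; [evl | nat_lia].
have cx : c (Ordinal zero_lt_n) = Ordinal zero_lt_n.
  by case: E gx => -> //; rewrite permM r1x.
have c1 : c = 1 by case/cycleP: cG cx => m -> /rho01_semiregular.
by case: E => ->; rewrite c1 ?mulg1 ?group1 // mem_GG //; nat_lia.
Qed.

(** [g] fixes y_(j+1), z_(j+1) and everything beyond them in both chains. On the z side [a] and [w]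
    are trivial there, so [s] fixes z_(j+1) and drops to [GG 3 j]; then [a] fixes y_(j+1) and its
    support shrinks to [Xp (j - 1)]. *)
Lemma step_0_low j g : (3 <= j)%N -> (j <= r - 3)%N ->
  g \in GG 0 j -> g \in GG 1 j.+1 -> g \in GG 1 j.
Proof.
move=> j3 jr gG gG'; have jr1 : (j < r)%N by nat_lia.
have [//||//|a [w [s [aX ae wG sG Eg]]]] := decompose _ _ _ gG'; first nat_lia.
have gfx (x : 'I_n) : (L + 2 + j <= x < L + r + 2)%N || (L + r + j <= x)%N -> g x = x.
  move=> xl; apply: GG_fix gG => k kij kr.
  have [k3|k3] := ltnP k 3; first by rewrite vmap_low //; nat_lia.
  by rewrite vmap_id //; nat_lia.
have wfx (x : 'I_n) : (L + 2 + j <= x)%N -> w x = x.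
  by move=> xl; apply: (GG_fix_high _ wG); nat_lia.
have afx (x : 'I_n) : (L + 3 + j <= x)%N -> a x = x.
  by move=> xl; apply: (out_vset aX); rewrite /=; nat_lia.
have sfx (x : 'I_n) : (L + r + j <= x)%N -> s x = x.
  move=> xl; have := gfx x; rewrite Eg !permM afx ?wfx; try nat_lia.
  by apply; nat_lia.
have sGj : s \in GG 3 j.
  have zn : (L + r + j < n)%N by nat_lia.
  have qz (q : {perm 'I_n}) : q \in GG 3 j -> q (Ordinal zn) = Ordinal zn.
    apply: GG_fix => k kij kr /=.
    have [Ek|nk] := eqVneq k (r - 3)%N; first by nat_lia.
    by rewrite vmap_id //; nat_lia.
  have [Ej|nj] := eqVneq j (r - 3)%N; last first.
    apply: (fix_right (k := 3) (x := Ordinal zn) _ _ _ (subxx _) _ _ _ sG) => //; try nat_lia.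
    by apply: sfx => /=; nat_lia.
  have ct h : h \in GG 3 j -> commute tau h.
    by apply: GG_gen_commute => k kij kr; apply: tau_commute; nat_lia.
  have tz : tau (Ordinal zn) = Ordinal zn by apply: val_inj; rewrite /= tauE vtau_id //=; nat_lia.
  have : s \in GG 3 j <*> <[tau]>.
    apply: (fix_right (k := 3) (x := Ordinal zn) _ _ _ _ _ _ _ sG) => //; try nat_lia.
    - exact: joing_subl.
    - move=> q /(join_tau ct)[|/qz]; first exact: qz.
      by rewrite permM => E; apply: (@perm_inj _ tau); rewrite E tz.
    - by move=> _ _; apply: (subsetP (joing_subr _ _)); apply: cycle_id.
    by apply: sfx => /=; nat_lia.
  (* The vertex z_r rules out the factor [tau]: both [s * tau] and [s] would fix it, but [tau] moves
     it. *)
  case/(join_tau ct) => // stG; have un : (L + 2 * r - 1 < n)%N by nat_lia.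
  have : (s * tau) (Ordinal un) = Ordinal un.
    apply: GG_fix stG => k kij kr /=; by rewrite vmap_id //; nat_lia.
  rewrite permM sfx /=; last nat_lia.
  by move/(congr1 val); rewrite /= tauE /=; evt.
have yn : (L + 2 + j < n)%N by nat_lia.
have ay : a (Ordinal yn) = Ordinal yn.
  have wy := wfx (Ordinal yn) (leqnn _).
  have sy : s (Ordinal yn) = Ordinal yn.
    apply: GG_fix sGj => k kij kr /=.
    have [Ek|nk] := eqVneq k (r - 3)%N; first by nat_lia.
    by rewrite vmap_id //; nat_lia.
  apply: (@perm_inj _ w); apply: (@perm_inj _ s); rewrite wy sy -!permM mulgA -Eg.
  by apply: gfx => /=; nat_lia.
have Ej : j = (j - 1).+1 by nat_lia.
rewrite Eg !groupM //.
- rewrite [in GG _ _]Ej; apply: alt_Xp1 => //; try nat_lia.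
  apply: perm_on_vset => x; have [Ex|nx] := eqVneq (nat_of_ord x) (L + 2 + j)%N.
    by move=> _; rewrite (_ : x = Ordinal yn) //; apply: val_inj.
  by move=> xX; apply: (out_vset aX); move: xX nx => /=; nat_lia.
- by apply: subsetP wG; apply: GG_S.
by apply: subsetP sGj; apply: GG_S.
Qed.

(* The vertices y_(r-1), y_r, z_(r-1), z_r; [rho 0], ..., [rho (r - 3)] permute them only through
   powers of [tau]. *)
Definition fourP := [pred x : nat | (L + r <= x < L + r + 2)%N || (L + 2 * r - 2 <= x)%N].

Lemma GG_sync (h : {perm 'I_n}) : h \in GG 0 (r - 2) ->
  (forall x : 'I_n, fourP x -> h x = x) \/ (forall x : 'I_n, fourP x -> h x = vtau x :> nat).
Proof.
move: h; apply: itv_gen_ind; first by left=> x _; rewrite perm1.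
have vtauK (x : nat) : (x < n)%N -> fourP x -> vtau (vtau x) = x.
  by move=> xn /orP[] ?; evt.
have vtau3 (x : nat) : (x < n)%N -> fourP x -> vmap (r - 3) x = vtau x.
  move=> xn xf; have : (x = L + r \/ x = L + r + 1 \/ x = L + 2 * r - 2 \/ x = L + 2 * r - 1)%N.
    by move: xf => /=; nat_lia.
  by regions x; evt.
have vtau4 (x : nat) : (x < n)%N -> fourP x -> fourP (vtau x) && (vtau x < n)%N.
  by move=> xn /orP[] ?; evt => /=; nat_lia.
have fixk k (x : nat) : (k < r - 3)%N -> fourP x -> vmap k x = x.
  move=> kr xf; have [k3|k3] := ltnP k 3; first by rewrite vmap_low //; move: xf => /=; nat_lia.
  by rewrite vmap_id //; move: xf => /=; nat_lia.
move=> g k kij kr E; have [Ek|nk] := eqVneq k (r - 3)%N.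
  case: E => gE; [right | left] => x xf.
    by rewrite permM gE // rhoE // Ek vtau3.
  have /andP[tf tn] := vtau4 x (ltn_ord x) xf.
  by apply: val_inj; rewrite /= permM rhoE // gE // Ek vtau3 // vtauK.
case: E => gE; [left | right] => x xf; rewrite permM.
  by apply: val_inj; rewrite gE //= rhoE // fixk //; nat_lia.
have /andP[tf tn] := vtau4 x (ltn_ord x) xf.
by rewrite rhoE // gE // fixk //; nat_lia.
Qed.

Local Notation zP := (itvP (L + r + 2) (L + 2 * r - 2)).

(** [h] is a permutation of y vertices and q_(L-1) times one of z vertices. If both are even, each
    lies in an alternating group already found; if both are odd, [rho 3] = (y_3 y_4)(z_3 z_4)
    corrects the two parities at once. *)
Lemma even_YZ (h : {perm 'I_n}) : ~~ odd_perm h ->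
  perm_on (vset [pred x : nat | (L + 2 <= x)%N && ~~ fourP x]) h ->
  (forall x : 'I_n, zP (h x) = zP x) -> h \in GG 1 (r - 2).
Proof.
move=> he hX hZ; have Er : (r - 2 = (r - 3).+1)%N by nat_lia.
have hN : h \in 'N(vset zP | 'P).
  by apply/astabsP=> x; rewrite /= apermE !inE; apply: hZ.
pose u := restr_perm (vset zP) h.
have uZ : perm_on (vset zP) u := restr_perm_on _ _.
have huY : perm_on (vset (Xp (r - 3))) (h * u^-1).
  apply: perm_on_vset => x xX; rewrite permM; apply: (@perm_inj _ u); rewrite permKV.
  have [xZ|xZ] := boolP (zP x); first by rewrite restr_permE // inE.
  rewrite (out_vset uZ xZ) (out_vset hX) //=.
  by move: xX xZ (ltn_ord x) => /=; nat_lia.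
have altY : alt_in (vset (Xp (r - 3))) (GG 1 (r - 2)) by rewrite Er; apply: alt_Xp1; nat_lia.
have [ue|ue] := boolP (odd_perm u); last first.
  rewrite -[h](mulgKV u) groupM //; last exact: alt_z.
  by apply: altY; rewrite // odd_permM odd_permV (negbTE he).
have y3n : (L + 4 < n)%N by nat_lia.
have y4n : (L + 5 < n)%N by nat_lia.
have z3n : (L + r + 2 < n)%N by nat_lia.
have z4n : (L + r + 3 < n)%N by nat_lia.
pose c := tperm (Ordinal y3n) (Ordinal y4n).
pose d := tperm (Ordinal z3n) (Ordinal z4n).
have cd : c * d = rho 3.
  apply: perm_nat_eq => x; rewrite permM !tperm_nat rhoE /=; last nat_lia.
  move: {x}(nat_of_ord x) (ltn_ord x) => x xn; rewrite /swap.
  have : (x < L + 4 \/ x = L + 4 \/ x = L + 5 \/ L + 5 < x < L + r + 2 \/ x = L + r + 2 \/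
    x = L + r + 3 \/ L + r + 3 < x)%N by nat_lia.
  by regions x; ev; ifs.
have -> : h = (h * u^-1 * c) * (c * d) * (d * u).
  by rewrite -!mulgA (mulgA d d) tperm2 mul1g (mulgA c c) tperm2 mul1g mulVg mulg1.
apply: groupM; first apply: groupM.
- apply: altY.
    by rewrite perm_onM // perm_on_tperm // inE /=; nat_lia.
  by rewrite !odd_permM odd_permV odd_tperm (negbTE he) ue -val_eqE /=; nat_lia.
- by rewrite cd mem_GG //; nat_lia.
apply: alt_z.
  by rewrite perm_onM // perm_on_tperm // inE /=; nat_lia.
by rewrite odd_permM odd_tperm ue -val_eqE /=; nat_lia.
Qed.

(** Conjugation by [w] preserves [Xp m], so removing [w] on the left leaves an element that is
    trivial on the path before q_(L-1). As [w] belongs to every group in question, only the tail has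
    to be studied. *)
Lemma decompose_high m g : (m < r)%N -> (2 <= m)%N -> g \in GG 1 m.+1 ->
  exists2 w, w \in GG 1 3 & perm_on (vset [pred x : nat | (L + 2 <= x)%N]) (w^-1 * g).
Proof.
move=> mr m2 gG; have [//||//|a [w [s [aX ae wG sG Eg]]]] := decompose _ _ _ gG; first nat_lia.
exists w => //; have -> : w^-1 * g = (w^-1 * a * w^-1^-1) * s by rewrite Eg invgK !mulgA.
have wVG : w^-1 \in GG 1 3 by rewrite groupV.
apply: perm_onM.
  have: perm_on (vset (Xp m)) (w^-1 * a * w^-1^-1).
    by apply: perm_on_conj aX => x; apply: (Xp_GG _ _ _ _ _ wVG); nat_lia.
  by apply: perm_onS; apply/subsetP=> x; rewrite !inE => /andP[].
by apply: perm_on_vset => x xl; apply: (GG_low _ _ sG); move: xl => /=; nat_lia.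
Qed.

Lemma rho_flip_on : perm_on (vset [pred x : nat | (L + 2 <= x)%N]) (rho (r - 3)).
Proof.
apply: perm_on_vset => x xl; apply: val_inj; rewrite /= rhoE; last nat_lia.
by move: xl => /= xl; ev.
Qed.

(** On the last two blocks the tail acts trivially or as [tau]. In the second case one factor
    [rho (r - 3)] undoes this, and [even_YZ] finishes. *)
Lemma step_0_r2 g : g \in GG 0 (r - 2) -> g \in GG 1 (r - 1) -> g \in GG 1 (r - 2).
Proof.
move=> gG gG'; rewrite (_ : r - 1 = (r - 2).+1)%N in gG'; last nat_lia.
have [||w wG hX] := decompose_high _ _ gG'; try nat_lia.
have wG2 : w \in GG 1 (r - 2) by apply: subsetP wG; apply: GG_S; nat_lia.
suff hG : w^-1 * g \in GG 1 (r - 2) by rewrite -[g](mulKVg w) groupM.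
have hG : w^-1 * g \in GG 0 (r - 2).
  by rewrite groupM // groupV; apply: subsetP wG; apply: GG_S; nat_lia.
have tG i : (i <= 1)%N -> rho (r - 3) \in GG i (r - 2) by move=> i1; apply: mem_GG; nat_lia.
move: (w^-1 * g) hX hG => h hX hG {g gG gG' w wG wG2}.
have zh q : q \in GG 0 (r - 2) -> forall x : 'I_n, zP (q x) = zP x.
  move=> qG; apply: (GG_stableE (P := zP) _ qG) => k x kij kr xn xz.
  have [k3|k3] := ltnP k 3; first by rewrite vmap_low //; move: xz => /=; nat_lia.
  have [Ek|nk] := eqVneq k (r - 3)%N.
    have : (L + r + 2 <= x < L + 2 * r - 4 \/ x = L + 2 * r - 4 \/ x = L + 2 * r - 3)%N.
      by move: xz => /=; nat_lia.
    by rewrite Ek; regions x; ev; rewrite /=; nat_lia.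
  have : (L + r + 2 <= x < L + r + k - 1 \/ x = L + r + k - 1 \/ x = L + r + k \/
    L + r + k + 1 <= x < L + 2 * r - 2)%N by move: xz => /=; nat_lia.
  by regions x; ev; rewrite /=; nat_lia.
suff [h' [h'G h'X h'4 Eh]] : exists h' : {perm 'I_n}, [/\ h' \in GG 0 (r - 2),
    perm_on (vset [pred x : nat | (L + 2 <= x)%N]) h', forall x : 'I_n, fourP x -> h' x = x &
    h = h' \/ h = h' * rho (r - 3)].
  have h'G1 : h' \in GG 1 (r - 2).
    apply: even_YZ; [exact: GG_even h'G | | exact: zh].
    apply: perm_on_vset => x; rewrite /= negb_and negbK => /orP[xl|xf]; last exact: h'4.
    exact: (out_vset h'X).
  by case: Eh => -> //; rewrite groupM // tG.
have [h4|h4] := GG_sync hG; first by exists h; split=> //; left.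
exists (h * rho (r - 3)); split.
- by rewrite groupM // tG.
- by rewrite perm_onM // rho_flip_on.
- move=> x xf; have [//|E|E] := GG_sync (h := h * rho (r - 3)); first by rewrite groupM // tG.
    exact: E.
  apply: val_inj; rewrite /= permM rhoE; last nat_lia.
  rewrite h4 //; have xn := ltn_ord x.
  have : (x = L + r :> nat \/ x = L + r + 1 :> nat \/ x = L + 2 * r - 2 :> nat \/
    x = L + 2 * r - 1 :> nat)%N by move: xf => /=; nat_lia.
  by case=> [->|[->|[->|->]]]; evt.
by right; rewrite -mulgA rhoK ?mulg1 //; nat_lia.
Qed.

(** The tail preserves the block {y_r, z_r}; up to a factor [rho (r - 3)] it fixes both vertices,
    and an even permutation of [Xp (r - 2)] remains. *)
Lemma step_0_r1 g : g \in GG 0 (r - 1) -> g \in GG 1 r -> g \in GG 1 (r - 1).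
Proof.
move=> gG gG'; have gG1 : g \in GG 1 (r - 1).+1 by apply: subsetP gG'; apply: GG_S; nat_lia.
have [||w wG hX] := decompose_high _ _ gG1; try nat_lia.
have wG2 : w \in GG 1 (r - 1) by apply: subsetP wG; apply: GG_S; nat_lia.
suff hG : w^-1 * g \in GG 1 (r - 1) by rewrite -[g](mulKVg w) groupM.
have hG : w^-1 * g \in GG 0 (r - 1).
  by rewrite groupM // groupV; apply: subsetP wG; apply: GG_S; nat_lia.
have tG i : (i <= 1)%N -> rho (r - 3) \in GG i (r - 1) by move=> i1; apply: mem_GG; nat_lia.
move: (w^-1 * g) hX hG => h hX hG {g gG gG' gG1 w wG wG2}.
have bh q : q \in GG 0 (r - 1) -> forall x : 'I_n, blockP x -> blockP (q x).
  move=> qG; apply: (GG_stable _ qG) => c y kc cr yn /orP[] /eqP->.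
    have [->|nc] := eqVneq c (r - 3)%N; first by rewrite /=; ev.
    by have [c2|c2] := ltnP c 3; [rewrite vmap_low /=; nat_lia | rewrite /=; ev].
  have [->|nc] := eqVneq c (r - 3)%N; first by rewrite /=; ev.
  by have [c2|c2] := ltnP c 3; [rewrite vmap_low /=; nat_lia | rewrite /=; ev].
have yn : (L + r + 1 < n)%N by nat_lia.
have zn : (L + 2 * r - 1 < n)%N by nat_lia.
have key h' : h' \in GG 0 (r - 1) -> perm_on (vset [pred x : nat | (L + 2 <= x)%N]) h' ->
    h' (Ordinal zn) = Ordinal zn -> h' \in GG 1 (r - 1).
  move=> h'G h'X h'z; rewrite (_ : r - 1 = (r - 2).+1)%N; last nat_lia.
  have h'y : h' (Ordinal yn) = Ordinal yn.
    have := bh _ h'G (Ordinal yn); rewrite /= eqxx => /(_ isT)/orP[] /eqP E.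
      exact: val_inj.
    have : h' (Ordinal yn) = h' (Ordinal zn) by rewrite h'z; apply: val_inj.
    by move/perm_inj/(congr1 val) => /=; nat_lia.
  apply: alt_Xp1; [nat_lia | nat_lia | | exact: GG_even h'G].
  apply: perm_on_vset => x xX; have [xl|xl] := ltnP x (L + 2).
    by apply: (out_vset h'X) => /=; nat_lia.
  have xn := ltn_ord x.
  have [E|nE] := eqVneq (nat_of_ord x) (L + r + 1)%N.
    by rewrite (_ : x = Ordinal yn) //; apply: val_inj.
  by rewrite (_ : x = Ordinal zn) //; apply: val_inj; move: xX => /=; nat_lia.
have := bh _ hG (Ordinal zn); rewrite /= eqxx orbT => /(_ isT)/orP[] /eqP E; last first.
  by apply: key => //; apply: val_inj.
have -> : h = h * rho (r - 3) * rho (r - 3) by rewrite -mulgA rhoK ?mulg1 //; nat_lia.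
rewrite groupM ?tG //; apply: key.
- by rewrite groupM // tG.
- by rewrite perm_onM // rho_flip_on.
by apply: val_inj; rewrite /= permM rhoE; [rewrite E; ev | nat_lia].
Qed.

Lemma interval_step i j : (i < j)%N -> (j < r)%N ->
  forall g, g \in GG i j -> g \in GG i.+1 j.+1 -> g \in GG i.+1 j.
Proof.
move=> ij jr g gG gG'.
have [i3|i3] := leqP 3 i.
  have [jr2|jr2] := leqP j (r - 2); first exact: step_high gG'.
  have Ej : j = (r - 1)%N by nat_lia.
  rewrite Ej in gG gG' *; apply: step_last => //; try nat_lia.
  by rewrite (_ : (r - 1).+1 = r) in gG' => //; nat_lia.
have [E2|n2] := eqVneq i 2.
  rewrite E2 in ij gG gG' *; have [jr2|jr2] := leqP j (r - 2); first exact: step_2 gG'.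
  have Ej : j = (r - 1)%N by nat_lia.
  rewrite Ej in gG gG' *; apply: step_last => //; try nat_lia.
  by rewrite (_ : (r - 1).+1 = r) in gG' => //; nat_lia.
have [E1|n1] := eqVneq i 1%N.
  by rewrite E1 in ij gG gG' *; apply: step_1.
have {n2 n1 i3} E0 : i = 0 by nat_lia.
rewrite E0 in ij gG gG' *.
have [j1|j1] := eqVneq j 1%N.
  rewrite j1 in gG gG' *; have [|->|Eg] := GG_single _ gG; [nat_lia | exact: group1 | ].
  have := GG_fix0 (x := Ordinal zero_lt_n) erefl gG'.
  by move/(congr1 val); rewrite /= Eg rhoE /=; [evl | nat_lia].
have [j2|j2] := eqVneq j 2; first by rewrite j2 in gG gG' *; apply: rho01_step.
have [jr3|jr3] := leqP j (r - 3); first by apply: step_0_low => //; nat_lia.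
have [jr2|jr2] := eqVneq j (r - 2)%N.
  rewrite jr2 in gG gG' *; apply: step_0_r2 => //.
  by rewrite (_ : (r - 2).+1 = r - 1)%N in gG' => //; nat_lia.
have Ej : j = (r - 1)%N by nat_lia.
rewrite Ej in gG gG' *; apply: step_0_r1 => //.
by rewrite (_ : (r - 1).+1 = r) in gG' => //; nat_lia.
Qed.

Lemma graph_string_C_group : string_C_group r rho.
Proof. by split; [exact: rho_sggi | exact: intersection_of_intervals rho_sggi interval_step]. Qed.

Lemma graph_group_Alt : gen_by rho [set: 'I_r] = 'Alt_('I_n)%G.
Proof.
have -> : gen_by rho [set: 'I_r] = GG 0 r.
  by congr (gen_by _ _); apply/setP=> k; rewrite !inE ltn_ord.
apply/val_inj/setP=> g /=; rewrite Alt_even; apply/idP/idP; first exact: GG_even.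
by move=> ge; apply: alt_total => //; apply/subsetP=> x; rewrite inE.
Qed.

End StringGroup.

Theorem theorem4p8 (n r : nat) :
  (15 <= n)%N -> n %% 4 = 3 -> odd r -> (7 <= r)%N -> (2 * r < n - 1)%N ->
  (Ggrp n r \isog 'Alt_('I_n))%g /\
  string_C_group r (rho n r) /\
  schlafli_type r (rho n r) (type48 n r).
Proof.
move=> _ n4 oddr r7 rn.
(* As [r] is odd, 2r is 2 modulo 4 and [L] is 1 modulo 4; [2 * r < n - 1] excludes [L = 1], hence
   [t.+1]. *)
have [t Lt] : exists t, (n - 2 * r = 4 * t.+1 + 1)%N by exists ((n - 2 * r - 5) %/ 4)%N; lia.
have [L EL] : exists L, L = (4 * t.+1 + 1)%N by exists (4 * t.+1 + 1)%N.
have En : n = (L + 2 * r)%N by lia.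
have [oddL L5] : odd L /\ (5 <= L)%N by lia.
clear n4 rn Lt; subst n.
have E k x := @rho_vmap L r oddL L5 r7 k x.
have ev k := @rho_vmap_even L r oddL L5 r7 k t.+1 EL.
split; last by split; [exact: (graph_string_C_group oddL L5 r7 E ev) |
  exact: (schlafli oddL L5 r7 E)].
by rewrite /Ggrp (graph_group_Alt oddL L5 r7 E ev) isog_refl.
Qed.
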